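(* Consider the FROST iterates $\mathbf{x}_k$ with step-size vector $\boldsymbol{\alpha}=[\alpha_1,\dots,\alpha_n]^\top$, $\overline{\alpha}=\max_i\alpha_i$, and all objects and constants as defined in the context. Suppose the largest step-size satisfies $$0<\overline{\alpha}<\min\left\{\frac{\delta_1(1-\sigma)}{a_1\delta_1+a_2\delta_2+a_3\delta_3},\ \frac{(1-\sigma)\delta_3-\delta_1a_6}{a_7\delta_1+a_8\delta_2+a_9\delta_3},\ \frac{1}{nl}\right\}$$ for some positive constants $\delta_1,\delta_2,\delta_3$ such that $\delta_3>0$, $\delta_1<\frac{(1-\sigma)\delta_3}{a_6}$ and $\delta_2>\frac{a_4\delta_1+a_5\delta_3}{\mu n[\boldsymbol{\pi}_r]_-}$, where $[\boldsymbol{\pi}_r]_-$ is the smallest element of $\boldsymbol{\pi}_r$. Then for every (arbitrarily small) constant $\xi>0$ there is a constant $m>0$ such that for all $k\ge0$ $$\|\mathbf{x}_k-\mathbf{1}_n\otimes\mathbf{x}^*\|\le m\left(\max\{\rho(J_{\boldsymbol{\alpha}}),\sigma\}+\xi\right)^k,$$ where $\rho(\cdot)$ denotes the spectral radius.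
   Context: Problem: $n$ agents communicate over a strongly-connected directed graph with vertex set $\{1,\dots,n\}$; $\mathcal{N}_i^{\rm in}$ is the set of in-neighbors of agent $i$ (agents that can send information to $i$), with $i\in\mathcal{N}_i^{\rm in}$. Each agent $i$ has $f_i:\mathbb{R}^p\to\mathbb{R}$, differentiable, with, for constants $l,\mu>0$ and all $\mathbf{x},\mathbf{y}\in\mathbb{R}^p$: $\|\nabla f_i(\mathbf{x})-\nabla f_i(\mathbf{y})\|_2\le l\|\mathbf{x}-\mathbf{y}\|_2$ and $f_i(\mathbf{y})\ge f_i(\mathbf{x})+\nabla f_i(\mathbf{x})^\top(\mathbf{y}-\mathbf{x})+\frac{\mu}{2}\|\mathbf{x}-\mathbf{y}\|_2^2$. Let $F=\frac1n\sum_{i=1}^n f_i$ and let $\mathbf{x}^*$ be its unique minimizer over $\mathbb{R}^p$. Weights: $\underline{A}=\{a_{ij}\}\in\mathbb{R}^{n\times n}$ is row-stochastic with $a_{ij}>0$ if $j\in\mathcal{N}_i^{\rm in}$ and $a_{ij}=0$ otherwise; hence it is primitive. $\boldsymbol{\pi}_r$ is its (positive) left Perron eigenvector, $\boldsymbol{\pi}_r^\top\underline{A}=\boldsymbol{\pi}_r^\top$, normalized by $\boldsymbol{\pi}_r^\top\mathbf{1}_n=1$. FROST algorithm: agent $i$ has a step-size $\alpha_i\ge0$; $D=\mathrm{diag}\{\boldsymbol{\alpha}\}\otimes I_p$, $A=\underline{A}\otimes I_p$, $\underline{Y}_0=I_n$, $\underline{Y}_{k+1}=\underline{A}\,\underline{Y}_k$,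 $Y_k=\underline{Y}_k\otimes I_p$, and $\widetilde{Y}_k=\mathrm{diag}(Y_k)$ is the diagonal matrix formed by the diagonal of $Y_k$ (it is invertible). For $\mathbf{x}=(\mathbf{x}^1,\dots,\mathbf{x}^n)\in\mathbb{R}^{np}$ let $\nabla\mathbf{f}(\mathbf{x})\in\mathbb{R}^{np}$ be the stacking of $\nabla f_1(\mathbf{x}^1),\dots,\nabla f_n(\mathbf{x}^n)$. With $\mathbf{x}_0\in\mathbb{R}^{np}$ arbitrary and $\mathbf{z}_0=\nabla\mathbf{f}(\mathbf{x}_0)$, $$\mathbf{x}_{k+1}=A\mathbf{x}_k-D\mathbf{z}_k,\qquad \mathbf{z}_{k+1}=A\mathbf{z}_k+\widetilde{Y}_{k+1}^{-1}\nabla\mathbf{f}(\mathbf{x}_{k+1})-\widetilde{Y}_k^{-1}\nabla\mathbf{f}(\mathbf{x}_k).$$ Constants: $Y_\infty=\lim_k Y_k=(\mathbf{1}_n\boldsymbol{\pi}_r^\top)\otimes I_p$; $\tau=\|A-I_{np}\|_2$; $\epsilon=\|I_{np}-Y_\infty\|_2$; $y=\sup_k\|Y_k\|_2$; $\widetilde{y}=\sup_k\|\widetilde{Y}_k^{-1}\|_2$. $\|\cdot\|_2$ is the Euclidean (spectral) norm. $\|\cdot\|$ is a fixed vector norm on $\mathbb{R}^{np}$ and $\sigma\in(0,1)$ a constant such that $\|A\mathbf{a}-Y_\infty\mathbf{a}\|\le\sigma\|\mathbf{a}-Y_\infty\mathbf{a}\|$ for all $\mathbf{a}\in\mathbb{R}^{np}$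 (such a norm exists). $c,d>0$ are constants with $\|\cdot\|_2\le c\|\cdot\|$ and $\|\cdot\|\le d\|\cdot\|_2$ on $\mathbb{R}^{np}$. Define (unrelated to the weights $a_{ij}$) $$a_1=cd\epsilon nl,\ a_2=d\epsilon nl,\ a_3=cd\epsilon,\ a_4=cnl,\ a_5=yc,\ a_6=\epsilon\widetilde{y}l\tau cd,\ a_7=cdnl^2\epsilon\widetilde{y},\ a_8=dnl^2\epsilon\widetilde{y},\ a_9=cd\epsilon l\widetilde{y},$$ $\lambda=\max\left(|1-n\boldsymbol{\pi}_r^\top\boldsymbol{\alpha}\mu|,|1-n\boldsymbol{\pi}_r^\top\boldsymbol{\alpha}l|\right)$, and $$J_{\boldsymbol{\alpha}}=\begin{bmatrix}\sigma+a_1\overline{\alpha}&a_2\overline{\alpha}&a_3\overline{\alpha}\\ a_4\overline{\alpha}&\lambda&a_5\overline{\alpha}\\ a_6+a_7\overline{\alpha}&a_8\overline{\alpha}&\sigma+a_9\overline{\alpha}\end{bmatrix}.$$ *)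

(* Defs.v *)
From HB Require Import structures.
From mathcomp Require Import all_boot all_order all_algebra.
From mathcomp Require Import all_classical all_reals all_analysis.
From mathcomp Require Import complex mxtens.

Set Implicit Arguments.
Unset Strict Implicit.
Unset Printing Implicit Defensive.

Import Order.TTheory GRing.Theory Num.Theory.
Import numFieldNormedType.Exports.

Local Open Scope ring_scope.
Local Open Scope classical_set_scope.

Section Norms.
Variable R : realType.

Definition norm2 (m : nat) (v : 'cV[R]_m) : R := Num.sqrt (\sum_i v i 0 ^+ 2).

Definition spectral_norm (m q : nat) (M : 'M[R]_(m, q)) : R :=
  sup [set norm2 (M *m v) | v in [set v : 'cV[R]_q | norm2 v <= 1]].

Record is_vector_norm (m : nat) (N : 'cV[R]_m -> R) : Prop := IsVectorNorm {
  vector_normD : forall u v, N (u + v) <= N u + N v ;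
  vector_normZ : forall (t : R) v, N (t *: v) = `|t| * N v ;
  vector_norm_eq0 : forall v, N v = 0 -> v = 0
}.

(* The eigenvalues of a real matrix are taken over the complex numbers R[i]. *)
Definition spectral_radius (m : nat) (M : 'M[R]_m) : R :=
  sup [set ComplexField.Normc.normc z | z in
       [set z : R[i] | eigenvalue (map_mx (real_complex R) M) z]].

End Norms.

Section Objectives.
Variables (R : realType) (p : nat).

Definition gradient (f : 'cV[R]_p -> R) (x : 'cV[R]_p) : 'cV[R]_p :=
  \col_j 'D_(delta_mx j 0) f x.

Definition lipschitz_gradient (l : R) (f : 'cV[R]_p -> R) : Prop :=
  forall x y, norm2 (gradient f x - gradient f y) <= l * norm2 (x - y).

Definition strongly_convex (mu : R) (f : 'cV[R]_p -> R) : Prop :=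
  forall x y, f x + ((gradient f x)^T *m (y - x)) 0 0
                + mu / 2 * norm2 (x - y) ^+ 2 <= f y.

Definition average (n : nat) (f : 'I_n -> 'cV[R]_p -> R) (x : 'cV[R]_p) : R :=
  n%:R^-1 * \sum_i f i x.

End Objectives.

Section Network.
Variable n : nat.

(* [E j i] : agent j can send information to agent i. *)
Definition in_neighbors (E : rel 'I_n) (i : 'I_n) : {set 'I_n} :=
  [set j | E j i].

Definition strongly_connected (E : rel 'I_n) : Prop :=
  forall i j, connect E i j.

Definition row_stochastic (R : realType) (A : 'M[R]_n) : Prop :=
  (forall i j, 0 <= A i j) /\ (forall i, \sum_j A i j = 1).

Definition compatible_weights (R : realType) (E : rel 'I_n) (A : 'M[R]_n) :
    Prop :=
  forall i j, (j \in in_neighbors E i -> 0 < A i j) /\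
              (j \notin in_neighbors E i -> A i j = 0).

Definition left_perron (R : realType) (A : 'M[R]_n) (pi_r : 'cV[R]_n) : Prop :=
  [/\ forall i, 0 < pi_r i 0,
      pi_r^T *m A = pi_r^T
    & pi_r^T *m const_mx 1 = 1%:M].

End Network.

(* Points of R^(np) are column vectors of length n * p; coordinate j of the
   block of agent i has index [mxtens_index (i, j)], which is the indexing of
   the Kronecker product [*t]. *)
Section Frost.
Variables (R : realType) (n p : nat).

Definition block (x : 'cV[R]_(n * p)) (i : 'I_n) : 'cV[R]_p :=
  \col_j x (mxtens_index (i, j)) 0.

Definition stack (v : 'I_n -> 'cV[R]_p) : 'cV[R]_(n * p) :=
  \col_k v (mxtens_unindex k).1 (mxtens_unindex k).2 0.

Definition consensus (v : 'cV[R]_p) : 'cV[R]_(n * p) :=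
  (const_mx 1 : 'cV[R]_n) *t v.

Definition stacked_gradient (f : 'I_n -> 'cV[R]_p -> R)
    (x : 'cV[R]_(n * p)) : 'cV[R]_(n * p) :=
  stack (fun i => gradient (f i) (block x i)).

Definition kronI (M : 'M[R]_n) : 'M[R]_(n * p) := M *t (1%:M : 'M[R]_p).

Definition Y (A : 'M[R]_n) (k : nat) : 'M[R]_(n * p) :=
  kronI (iter k (mulmx A) 1%:M).

Definition Ytilde (A : 'M[R]_n) (k : nat) : 'M[R]_(n * p) :=
  diag_mx (\row_i Y A k i i).

(* The closed form 1 pi_r^T (x) I of the limit of [Y A k]. *)
Definition Yinf (pi_r : 'cV[R]_n) : 'M[R]_(n * p) :=
  kronI (const_mx 1 *m pi_r^T).

Fixpoint frost (A : 'M[R]_n) (alpha : 'cV[R]_n) (f : 'I_n -> 'cV[R]_p -> R)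
    (x0 : 'cV[R]_(n * p)) (k : nat) : 'cV[R]_(n * p) * 'cV[R]_(n * p) :=
  if k is k'.+1 then
    let: (x, z) := frost A alpha f x0 k' in
    let x' := kronI A *m x - kronI (diag_mx alpha^T) *m z in
    (x', kronI A *m z + invmx (Ytilde A k'.+1) *m stacked_gradient f x'
                      - invmx (Ytilde A k') *m stacked_gradient f x)
  else (x0, stacked_gradient f x0).

Definition frost_x A alpha f x0 k := (frost A alpha f x0 k).1.

End Frost.

Section StepSizes.
Variables (R : realType) (n : nat).

Definition max_entry (v : 'cV[R]_n) : R := sup (range (fun i => v i 0)).

Definition min_entry (v : 'cV[R]_n) : R := inf (range (fun i => v i 0)).

Definition mx_of_rows (m : nat) (rows : seq (seq R)) : 'M[R]_m :=
  \matrix_(i, j) nth 0 (nth [::] rows i) j.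

End StepSizes.

(* In [\bar R], 0^-1 = +oo. The denominators below vanish only in degenerate
   cases such as n = 1, where the bounds are then void. *)
Definition quotient_bound (R : realType) (a b : R) : \bar R :=
  (a%:E / b%:E)%E.

(* Main.v *)
(* With [P] the consensus projection, the three errors |x_k - P x_k|,
   |P x_k - 1 (x) x^*|_2 and |z_k - P z_k| satisfy a linear recursion
   t_(k+1) <= J t_k + sigma^k (C |t_k| + C'). The perturbation comes from
   Ytilde_k^-1, which approaches its limit at rate sigma, and the entry lambda
   is the contraction factor of a gradient step on sum_i f_i, whose gradient is
   averaged by z_k. For r above the spectral radius of the nonnegative matrix J
   there is a positive v with J v <= r v, and comparing t_k with multiples of
   r^k v gives the rate. *)
Require Import Defs.
From HB Require Import structures.
From mathcomp Require Import all_boot all_order all_algebra.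
From mathcomp Require Import all_classical all_reals all_analysis.
From mathcomp Require Import complex mxtens.
From mathcomp Require Import ring lra.

Set Implicit Arguments.
Unset Strict Implicit.
Unset Printing Implicit Defensive.

Import Order.TTheory GRing.Theory Num.Theory.
Import numFieldNormedType.Exports.

Local Open Scope ring_scope.
Local Open Scope classical_set_scope.

(** * Euclidean inner product, Cauchy-Schwarz, and the spectral norm *)

Section EuclideanNorm.
Variable R : realType.

(** Three obstacles shape the argument. The gradients that multiply the perturbation are not bounded
    in advance; the Lipschitz condition bounds them by the errors themselves, which is the origin of
    the term C |t_k|. Row-stochastic mixing would weight the gradient of agent j by the j-th entry
    of [pi_r]; dividing by the diagonal of Y_k, whose limit carries these same entries, makes all
    weights equal, so that P z_k follows the plain sum of the gradients. And [J] may be reducible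
    (every constant with a factor [eps] vanishes when n = 1), so its Perron vector need not be
    positive: v comes instead from the resolvent at a real point r1 < r above the spectrum, and the
    room r - r1 absorbs the perturbation at late times. In the averaged recursion, P D P = (pi_r^T
    alpha) P merges the step-sizes into the single step pi_r^T alpha, and abar < 1 / (n l) keeps it
    short enough for a function with parameters n mu and n l. *)

Definition dot (m : nat) (u v : 'cV[R]_m) : R := (u^T *m v) 0 0.

Lemma dotE m (u v : 'cV[R]_m) : dot u v = \sum_i u i 0 * v i 0.
Proof. by rewrite /dot mxE; apply: eq_bigr => i _; rewrite mxE. Qed.

Lemma dotC m (u v : 'cV[R]_m) : dot u v = dot v u.
Proof. by rewrite !dotE; apply: eq_bigr => i _; rewrite mulrC. Qed.

Lemma dotDr m (u v w : 'cV[R]_m) : dot u (v + w) = dot u v + dot u w.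
Proof. by rewrite /dot mulmxDr mxE. Qed.

Lemma dotZr m (u v : 'cV[R]_m) (t : R) : dot u (t *: v) = t * dot u v.
Proof. by rewrite /dot -scalemxAr mxE. Qed.

Lemma dotDl m (u v w : 'cV[R]_m) : dot (u + v) w = dot u w + dot v w.
Proof. by rewrite dotC dotDr !(dotC w). Qed.

Lemma dotZl m (u v : 'cV[R]_m) (t : R) : dot (t *: u) v = t * dot u v.
Proof. by rewrite dotC dotZr dotC. Qed.

Lemma dotNr m (u v : 'cV[R]_m) : dot u (- v) = - dot u v.
Proof. by rewrite -scaleN1r dotZr mulN1r. Qed.

Lemma dotNl m (u v : 'cV[R]_m) : dot (- u) v = - dot u v.
Proof. by rewrite dotC dotNr dotC. Qed.

Lemma norm2_ge0 m (v : 'cV[R]_m) : 0 <= norm2 v.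
Proof. exact: sqrtr_ge0. Qed.

Lemma norm2_sqr m (v : 'cV[R]_m) : norm2 v ^+ 2 = dot v v.
Proof.
rewrite sqr_sqrtr; last by apply: sumr_ge0 => i _; exact: sqr_ge0.
by rewrite dotE; apply: eq_bigr => i _; rewrite expr2.
Qed.

Lemma norm2Z m (t : R) (v : 'cV[R]_m) : norm2 (t *: v) = `|t| * norm2 v.
Proof.
apply/eqP; rewrite -(eqrXn2 (n := 2)) ?mulr_ge0 ?norm2_ge0 //.
by rewrite exprMn !norm2_sqr dotZl dotZr mulrA -expr2 real_normK ?num_real.
Qed.

Lemma norm2N m (v : 'cV[R]_m) : norm2 (- v) = norm2 v.
Proof. by rewrite -scaleN1r norm2Z normrN1 mul1r. Qed.

Lemma norm2_0 m : norm2 (0 : 'cV[R]_m) = 0.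
Proof. by rewrite -(scale0r 0) norm2Z normr0 mul0r. Qed.

Lemma norm2_coord m (v : 'cV[R]_m) i : `|v i 0| <= norm2 v.
Proof.
rewrite -(ler_pXn2r (n := 2)) ?nnegrE ?norm2_ge0 //.
rewrite norm2_sqr dotE (bigD1 i) //= real_normK ?num_real // expr2.
by rewrite lerDl; apply: sumr_ge0 => j _; rewrite -expr2 sqr_ge0.
Qed.

Lemma norm2_eq0 m (v : 'cV[R]_m) : norm2 v = 0 -> v = 0.
Proof.
move=> v0; apply/colP => i; rewrite mxE; apply/eqP.
by rewrite -normr_le0 -v0 norm2_coord.
Qed.

Lemma Cauchy_Schwarz m (u v : 'cV[R]_m) : dot u v <= norm2 u * norm2 v.
Proof.
have [/eqP v0|vn0] := boolP (norm2 v == 0).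
  by rewrite v0 (norm2_eq0 v0) mulr0 -(scale0r 0) dotZr mul0r.
have v_gt0 : 0 < dot v v by rewrite -norm2_sqr exprn_gt0 // lt0r vn0 norm2_ge0.
rewrite (le_trans (ler_norm _)) // -(ler_pXn2r (n := 2)) ?nnegrE ?mulr_ge0 ?norm2_ge0 //.
rewrite real_normK ?num_real // exprMn !norm2_sqr -(ler_pM2l v_gt0).
(* The component of [u] orthogonal to [v], multiplied by [dot v v] to avoid a division. *)
have : 0 <= dot (dot v v *: u - dot u v *: v) (dot v v *: u - dot u v *: v).
  by rewrite -norm2_sqr sqr_ge0.
rewrite !(dotDl, dotDr, dotNl, dotNr, dotZl, dotZr) (dotC v u).
nra.
Qed.

Lemma norm2D m (u v : 'cV[R]_m) : norm2 (u + v) <= norm2 u + norm2 v.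
Proof.
rewrite -(ler_pXn2r (n := 2)) ?nnegrE ?addr_ge0 ?norm2_ge0 //.
rewrite sqrrD !norm2_sqr !(dotDl, dotDr) (dotC v u).
have := Cauchy_Schwarz u v; lra.
Qed.

Lemma norm2B m (u v : 'cV[R]_m) : norm2 (u - v) <= norm2 u + norm2 v.
Proof. by rewrite -(norm2N v) norm2D. Qed.

Lemma norm2_dist m (u v w : 'cV[R]_m) : norm2 (u - w) <= norm2 (u - v) + norm2 (v - w).
Proof. by rewrite -{1}(subrK v u) -addrA norm2D. Qed.

Lemma norm2_sum m (I : finType) (F : I -> 'cV[R]_m) :
  norm2 (\sum_i F i) <= \sum_i norm2 (F i).
Proof.
elim/big_ind2 : _ => [|x a y b xa yb|//]; first by rewrite norm2_0.
by rewrite (le_trans (norm2D _ _)) // lerD.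
Qed.

Lemma norm2_le_sum m (v : 'cV[R]_m) : norm2 v <= \sum_i `|v i 0|.
Proof.
rewrite -(ler_pXn2r (n := 2)) ?nnegrE ?norm2_ge0 ?sumr_ge0 //.
rewrite norm2_sqr dotE expr2 mulr_suml; apply: ler_sum => i _.
rewrite (le_trans (ler_norm _)) // normrM ler_wpM2l //.
by rewrite (bigD1 i) //= lerDl sumr_ge0.
Qed.

(** On an unbounded set [sup] is only a default value, so this is what makes the spectral norm an
    actual bound. *)
Lemma spectral_norm_has_ubound m q (M : 'M[R]_(m, q)) :
  has_ubound [set norm2 (M *m v) | v in [set v : 'cV[R]_q | norm2 v <= 1]].
Proof.
exists (\sum_i \sum_j `|M i j|) => _ /= [v v1 <-].
apply: le_trans (norm2_le_sum _) _; apply: ler_sum => i _.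
rewrite mxE (le_trans (ler_norm_sum _ _ _)) //; apply: ler_sum => j _.
by rewrite normrM ler_piMr // (le_trans (norm2_coord _ _)).
Qed.

Lemma spectral_norm_ge0 m q (M : 'M[R]_(m, q)) : 0 <= spectral_norm M.
Proof.
apply: (le_trans (norm2_ge0 (M *m 0))).
apply: ub_le_sup; first exact: spectral_norm_has_ubound.
by exists 0 => //=; rewrite norm2_0.
Qed.

Lemma norm2_mulmx m q (M : 'M[R]_(m, q)) v :
  norm2 (M *m v) <= spectral_norm M * norm2 v.
Proof.
have [/eqP v0|vn0] := boolP (norm2 v == 0).
  by rewrite v0 mulr0 (norm2_eq0 v0) mulmx0 norm2_0.
have v_gt0 : 0 < norm2 v by rewrite lt0r vn0 norm2_ge0.
rewrite -ler_pdivrMr //.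
have -> : norm2 (M *m v) / norm2 v = norm2 (M *m ((norm2 v)^-1 *: v)).
  by rewrite -scalemxAr norm2Z mulrC ger0_norm // invr_ge0 ltW.
apply: ub_le_sup; first exact: spectral_norm_has_ubound.
by exists ((norm2 v)^-1 *: v) => //=; rewrite norm2Z ger0_norm ?mulVf // invr_ge0 ltW.
Qed.

Lemma spectral_norm_le m q (M : 'M[R]_(m, q)) (C : R) : 0 <= C ->
  (forall v, norm2 (M *m v) <= C * norm2 v) -> spectral_norm M <= C.
Proof.
move=> C0 MC; apply: ge_sup; first by exists (norm2 (M *m 0)), 0 => //=; rewrite norm2_0.
move=> _ /= [v v1 <-]; apply: le_trans (MC _) _.
by rewrite ler_piMr.
Qed.

End EuclideanNorm.

(** * Contraction of a gradient step for a smooth strongly convex function *)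

Section StronglyConvexDescent.
Variables (R : realType) (q : nat) (F : 'cV[R]_q -> R) (G : 'cV[R]_q -> 'cV[R]_q).
Variables (mu l : R).
Hypotheses (mu_gt0 : 0 < mu) (l_gt0 : 0 < l).
Hypothesis F_convex : forall x y,
  F x + dot (G x) (y - x) + mu / 2 * norm2 (x - y) ^+ 2 <= F y.
Hypothesis G_lip : forall x y, norm2 (G x - G y) <= l * norm2 (x - y).

(* Convexity at the far end of each of the [j] steps, and the Lipschitz bound
   on the drift of the gradient: a Riemann sum in place of the integral of the
   derivative along the segment. *)
Lemma descent_steps x h j :
  F (x + j%:R *: h) <=
  F x + j%:R * dot (G x) h + l * (j%:R * (j%:R + 1) / 2) * dot h h.
Proof.
elim: j => [|j IH]; first by rewrite scale0r addr0 !mul0r mulr0 mul0r !addr0.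
set xj := x + j%:R *: h in IH *; set xS := x + _.
have xjS : xj - xS = - h.
  by rewrite /xj /xS opprD addrACA subrr add0r -scalerBl -natr1 opprD addrA
    subrr add0r scaleN1r.
have := F_convex xS xj; rewrite xjS dotNr.
have : 0 <= mu / 2 * norm2 (xS - xj) ^+ 2 by rewrite mulr_ge0 ?sqr_ge0 // divr_ge0 ?ltW.
have : dot (G xS - G x) h <= l * (j%:R + 1) * dot h h.
  apply: le_trans (Cauchy_Schwarz _ _) _.
  apply: le_trans (ler_wpM2r (norm2_ge0 _) (G_lip _ _)) _.
  rewrite /xS addrC addKr norm2Z ger0_norm // -norm2_sqr expr2 natr1.
  by rewrite le_eqVlt; apply/orP; left; apply/eqP; ring.
rewrite dotDl dotNl -[j.+1%:R]natr1.
move: IH; set D := dot h h; set a := dot (G x) h; set b := dot (G xS) h.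
set J := (j%:R : R). lra.
Qed.

Lemma descent x y :
  F y <= F x + dot (G x) (y - x) + l / 2 * norm2 (y - x) ^+ 2.
Proof.
set w := y - x; rewrite norm2_sqr; set D := dot w w.
have D0 : 0 <= D by rewrite /D -norm2_sqr sqr_ge0.
apply/ler_addgt0Pl => e e0.
(* With m > l D / e steps, the excess l D / (2 m) of the Riemann sum over l D / 2 stays below e. *)
pose m := (Num.truncn (l * D / e)).+1; have m0 : (0 : R) < m%:R by rewrite ltr0n.
have lDe : l * D < m%:R * e by rewrite -ltr_pdivrMr // truncnS_gt.
have := descent_steps x (m%:R^-1 *: w) m.
rewrite scalerA divff ?gt_eqF // scale1r addrC subrK dotZl !dotZr -/D.
have -> : m%:R * (m%:R^-1 * dot (G x) w) = dot (G x) w by field; rewrite gt_eqF.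
have -> : l * (m%:R * (m%:R + 1) / 2) * (m%:R^-1 * (m%:R^-1 * D)) =
  l / 2 * D + l * D / m%:R / 2 by field; rewrite gt_eqF.
have : l * D / m%:R <= e by rewrite ler_pdivrMr // [e * _]mulrC ltW.
lra.
Qed.

(** A step of length 1 / l against [G x] lowers [F] by at least |G x|^2 / (2 l), which a minimizer
    forbids unless [G x] is zero. *)
Lemma minimizer_gradient_eq0 x : (forall y, F x <= F y) -> G x = 0.
Proof.
move=> xmin; apply: norm2_eq0; apply/eqP; rewrite -sqrf_eq0.
have := xmin (x - l^-1 *: G x); have := descent x (x - l^-1 *: G x).
rewrite [_ - _ - x]addrC addKr -scaleNr norm2Z dotZr -norm2_sqr normrN.
have li : 0 <= l^-1 by rewrite invr_ge0 ltW.
rewrite (ger0_norm li) exprMn.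
have -> : l / 2 * (l^-1 ^+ 2 * norm2 (G x) ^+ 2) = l^-1 * norm2 (G x) ^+ 2 / 2.
  by field; rewrite gt_eqF.
move=> A B; have : l^-1 * norm2 (G x) ^+ 2 <= 0 by lra.
by rewrite pmulr_rle0 ?invr_gt0 // => C; rewrite eq_le C sqr_ge0.
Qed.

(* The test point is [y - t u]; [u] is the increment of the gradient of the
   convex function [F - mu/2 |.|^2]. *)
Lemma cocoercive_half x y u t : G y = u + G x + mu *: (y - x) ->
  F x + dot (G x) (y - x) + mu / 2 * dot (y - x) (y - x)
    + (t - (l - mu) / 2 * t ^+ 2) * dot u u <= F y.
Proof.
have := F_convex x (y - t *: u); have := descent y (y - t *: u).
rewrite [y - _ - y]addrC addKr !norm2_sqr.
have -> : y - t *: u - x = y - x - t *: u by rewrite addrAC.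
have -> : x - (y - t *: u) = - (y - x - t *: u) by rewrite !opprB addrCA addrA.
set w := y - x => A B GE; move: A B; rewrite GE; clearbody w.
rewrite !(dotDl, dotDr, dotNl, dotNr, dotZl, dotZr) (dotC w u).
move: (dot _ _) (dot _ _) (dot _ _) (dot _ _) (F _) (F _) (F _) => a b c0 d e f g.
nra.
Qed.

(** Adding the half inequality to its copy with [x] and [y] exchanged cancels the values of [F]. The
    usual cocoercivity is the case t = 1 / (l - mu); a free [t] avoids dividing by l - mu, which is
    zero when l = mu. *)
Lemma cocoercive x y u t : G y = u + G x + mu *: (y - x) ->
  (2 * t - (l - mu) * t ^+ 2) * dot u u <= dot u (y - x).
Proof.
move=> GE; have := cocoercive_half t GE.
have := @cocoercive_half y x (- u) t.
rewrite GE -(opprB y x); set w := y - x; clearbody w => /(_ _)/wrap[].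
  by rewrite scalerN -!addrA addKr subrr addr0.
rewrite !(dotDl, dotDr, dotNl, dotNr, dotZl, dotZr).
lra.
Qed.

(** Writing the increment of [G] as u + mu w, the step sends w to k w - eta u with k = 1 - eta mu.
    After squaring, the cross term 2 eta k <u, w> has to outweigh eta^2 |u|^2, and cocoercivity
    provides this. *)
Lemma gradient_step_contraction eta x y : 0 <= eta -> eta * l < 1 ->
  norm2 (y - x - eta *: (G y - G x)) <= `|1 - eta * mu| * norm2 (y - x).
Proof.
move=> eta0 etal; set w := y - x.
(* The inequality mu <= l is read off below from the quadratic bounds along [w], which takes a
   nonzero [w]; in dimension 0 it can fail. *)
have [/eqP w0|wn0] := boolP (dot w w == 0).
  have yx : y = x by apply/eqP; rewrite -subr_eq0 (@norm2_eq0 _ _ (y - x)) //;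
    apply/eqP; rewrite -sqrf_eq0 norm2_sqr -/w w0.
  by rewrite /w yx !subrr scaler0 subrr norm2_0 mulr0.
have w_gt0 : 0 < dot w w by rewrite lt0r wn0 -norm2_sqr sqr_ge0.
have mul : mu <= l.
  have := F_convex x y; have := descent x y.
  rewrite -(opprB y x) norm2N -/w norm2_sqr => A B.
  have : mu * dot w w <= l * dot w w by lra.
  by rewrite ler_pM2r.
have k_gt0 : 0 < 1 - eta * mu by nra.
rewrite -(ler_pXn2r (n := 2)) ?nnegrE ?mulr_ge0 ?norm2_ge0 //.
rewrite exprMn real_normK ?num_real // !norm2_sqr.
pose u := G y - G x - mu *: w.
have uE : G y - G x = u + mu *: w by rewrite /u subrK.
(* For this t, (l - mu) t <= 1 amounts to eta l <= 1, and then 2 t - (l - mu) t^2 >= t. *)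
have := @cocoercive x y u (eta / (1 - eta * mu)).
rewrite -/w {1}addrAC -{1}uE subrK uE => /(_ erefl).
have u0 : 0 <= dot u u by rewrite -norm2_sqr sqr_ge0.
clearbody w u; set k := 1 - eta * mu in k_gt0 *.
set t := eta / k; have tk : t * k = eta by rewrite /t divfK // gt_eqF.
have t0 : 0 <= t by rewrite divr_ge0 // ltW.
have Lt : (l - mu) * t <= 1.
  have : (l - mu) * t * k <= 1 * k by rewrite -mulrA tk /k; lra.
  by rewrite ler_pM2r.
have A : t * dot u u <= (2 * t - (l - mu) * t ^+ 2) * dot u u.
  by apply: ler_wpM2r => //; nra.
move=> /(le_trans A) {}A.
have {}A : eta * (eta * dot u u) <= eta * (k * dot u w).
  by rewrite ler_wpM2l // -tk [t * k]mulrC -mulrA ler_pM2l.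
have kw : 0 <= eta * (k * dot u w).
  by apply: le_trans A; rewrite !mulr_ge0.
have -> : w - eta *: (u + mu *: w) = k *: w - eta *: u.
  by rewrite scalerDr scalerA opprD addrCA addrC /k scalerBl scale1r.
rewrite !(dotDl, dotDr, dotNl, dotNr, dotZl, dotZr) (dotC w u).
nra.
Qed.

End StronglyConvexDescent.

(** * Nonnegative matrices and linear recursions with a decaying perturbation *)

Section NonnegativeMatrices.
Variable R : realType.

Lemma bigmin_continuous (I : Type) (s : seq I) (x : R) (F : I -> R -> R) :
  (forall i, continuous (F i)) ->
  continuous (fun t => \big[Num.min/x]_(i <- s) F i t).
Proof.
move=> Fc; elim: s => [|i s IH] t.
  by under eq_fun do rewrite big_nil; exact: cvg_cst.
under eq_fun do rewrite big_cons.
exact: (@continuous_min R R (F i) _ t (Fc i t) (IH t)).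
Qed.

(* [V s] is a positive multiple of [(s I - M)^-1 1], with polynomial entries.
   Wherever [V s >= 0] one has [s V >= chi(s)^2 > 0], so its least entry never
   vanishes on the half-line above the real spectrum; it is positive for large
   [s], hence on the whole half-line. *)
Lemma nonneg_mx_subeigenvector (n : nat) (M : 'M[R]_n) (r : R) : 0 < r ->
  (forall i j, 0 <= M i j) ->
  (forall s, r <= s -> ~~ eigenvalue M s) ->
  exists v : 'I_n -> R, (forall i, 0 < v i) /\
    (forall i, \sum_j M i j * v j <= r * v i).
Proof.
move=> r0 M0 Mr.
pose chi := char_poly M.
pose P : 'cV[{poly R}]_n := chi *: (\adj (char_poly_mx M) *m const_mx 1).
pose V i s := (P i 0).[s].
have VE s i : s * V i s - \sum_j M i j * V j s = chi.[s] ^+ 2.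
  have /colP/(_ i) : char_poly_mx M *m P = const_mx (chi ^+ 2).
    by rewrite -scalemxAr mulmxA mul_mx_adj mul_scalar_mx scalerA -expr2;
      apply/colP => k; rewrite !mxE mulr1.
  rewrite [LHS]mxE [RHS]mxE => /(congr1 (horner^~ s)).
  rewrite horner_exp horner_sum => <-.
  have charE j : (char_poly_mx M i j).[s] = s *+ (i == j) - M i j.
    by rewrite !mxE hornerD hornerN hornerC hornerMn hornerX.
  under [RHS]eq_bigr do rewrite hornerM charE mulrBl.
  rewrite sumrB; congr (_ - _); rewrite (bigD1 i) //= eqxx mulr1n.
  by rewrite big1 ?addr0 // => j /negPf; rewrite eq_sym => ->; rewrite mul0r.
have chi2 s : r <= s -> 0 < chi.[s] ^+ 2.
  move=> /Mr; rewrite eigenvalue_root_char -/chi /root => chis.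
  by rewrite exprn_even_gt0.
have Vpos s : r <= s -> (forall i, 0 <= V i s) -> forall i, 0 < V i s.
  move=> rs V0 i; have s0 : 0 < s by apply: lt_le_trans rs.
  rewrite -(pmulr_rgt0 _ s0); apply: lt_le_trans (chi2 s rs) _.
  by rewrite -(VE s i) lerBlDr lerDl sumr_ge0 // => j _; rewrite mulr_ge0.
pose S := r + \sum_i \sum_j M i j.
have rS : r <= S by rewrite lerDl !sumr_ge0 // => i _; rewrite sumr_ge0.
(* [S] exceeds every row sum, so at the index k of the least entry chi(S)^2 <= (S - sum_j M_kj) V_k,
   which forces V_k >= 0. *)
have VS i : 0 <= V i S.
  have [k _ kmin] := @Order.TotalTheory.arg_minP _ _ _ i xpredT (V^~ S) isT.
  apply: le_trans (kmin i isT).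
  have Mk : 0 < S - \sum_j M k j.
    rewrite /S (bigD1 k) //= addrCA addrAC subrr add0r.
    by apply: ltr_wpDr => //; apply: sumr_ge0 => j _; apply: sumr_ge0.
  rewrite -(pmulr_rge0 _ Mk); apply: le_trans (ltW (chi2 S rS)) _.
  rewrite -(VE S k) mulrBl lerB // mulr_suml; apply: ler_sum => j _.
  by rewrite ler_wpM2l // kmin.
(* The value 1 covers n = 0 and otherwise caps the minimum without changing its sign or its
   zeros. *)
pose h s := \big[Num.min/1]_i V i s.
have hS : 0 < h S.
  by apply: lt_bigmin => // i _; apply: Vpos.
have hr : 0 < h r.
  rewrite ltNge; apply/negP => hr.
  have hc : {within `[r, S], continuous h}.
    apply: continuous_subspaceT; apply: bigmin_continuous => i.
    exact: continuous_horner.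
  have [|s /itvP rsS hs0] := IVT rS hc (v := 0).
    by rewrite ge_min hr /= le_max (ltW hS) orbT.
  have : 0 < h s.
    apply: lt_bigmin => // i _; apply: Vpos => [|j]; first by rewrite rsS.
    by rewrite -hs0; apply: bigmin_le_cond.
  by rewrite hs0 ltxx.
exists (V^~ r); split => i.
  apply: lt_le_trans hr _; exact: bigmin_le_cond.
by rewrite -subr_ge0 VE sqr_ge0.
Qed.

(** The complex eigenvalues are the roots of a split polynomial, so the sum of the moduli of its
    roots bounds the set under [sup]. Real eigenvalues suffice here because the subeigenvector is
    found by moving along a real half-line. *)
Lemma spectral_radius_ub (n : nat) (M : 'M[R]_n) (s : R) :
  eigenvalue M s -> `|s| <= spectral_radius M.
Proof.
move=> Ms.
have -> : `|s| = ComplexField.Normc.normc (real_complex R s).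
  by rewrite /= expr0n addr0 sqrtr_sqr.
apply: ub_le_sup; last by exists (real_complex R s); rewrite //= eigenvalue_map.
set Q := char_poly (map_mx (real_complex R) M).
have [rs QE] := closed_field_poly_normal Q.
exists (\sum_(z <- rs) ComplexField.Normc.normc z) => _ /= [z Mz <-].
have : z \in rs.
  move: Mz; rewrite eigenvalue_root_char -/Q QE (monicP (char_poly_monic _)).
  by rewrite scale1r root_prod_XsubC.
move=> zrs; rewrite (big_rem z) //= lerDl sumr_ge0 // => w _.
by case: w => a b; exact: sqrtr_ge0.
Qed.

Lemma geometric_small (q e : R) : 0 <= q < 1 -> 0 < e ->
  exists K, forall k, (K <= k)%N -> q ^+ k < e.
Proof.
move=> /andP[q0 q1] e0.
have /cvgrPdist_lt/(_ e e0)[K _ KP] : (GRing.exp q : R^nat) @ \oo --> (0 : R).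
  by apply: cvg_expr; rewrite ger0_norm.
by exists K => k /KP /=; rewrite sub0r normrN ger0_norm ?exprn_ge0.
Qed.

(** Induction on k shows t_k <= m r^k v: the matrix uses up only r1 v of the allowed r v, the
    perturbation fits into the rest once k is large, and the finitely many earlier times are
    absorbed in [m]. *)
Lemma perturbed_linear_recursion (n : nat) (M : 'M[R]_n) (t : nat -> 'I_n -> R)
    (sigma r C C' : R) :
  0 < sigma < 1 -> sigma < r -> 0 <= C -> 0 <= C' ->
  (forall i j, 0 <= M i j) -> (forall k i, 0 <= t k i) ->
  spectral_radius M < r ->
  (forall k i, t k.+1 i <=
     \sum_j M i j * t k j + sigma ^+ k * (C * \sum_j t k j + C')) ->
  exists2 m, 0 < m & forall k i, t k i <= m * r ^+ k.
Proof.
move=> /andP[s0 s1] sr C0 C'0 M0 t0 Mr rec.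
have r0 : 0 < r by exact: lt_trans sr.
(* Strictly between the spectral radius and [r]; the maximum with [r / 2] makes positivity
   immediate. *)
pose r1 := Num.max (r / 2) ((spectral_radius M + r) / 2).
have r10 : 0 < r1 by rewrite /r1 lt_max; apply/orP; left; lra.
have r1r : r1 < r by rewrite /r1 gt_max; apply/andP; split; lra.
have noeig s : r1 <= s -> ~~ eigenvalue M s.
  move=> r1s; apply/negP => /spectral_radius_ub.
  rewrite leNgt => /negP; apply; apply: lt_le_trans (ler_norm _).
  by apply: lt_le_trans r1s; rewrite /r1 lt_max; apply/orP; right; lra.
have [v [v0 Mv]] := nonneg_mx_subeigenvector r10 M0 noeig.
have [v1 v10 v1v] : exists2 v1, 0 < v1 & forall i, v1 <= v i.
  exists (\big[Num.min/1]_i v i); first exact: lt_bigmin.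
  by move=> i; exact: bigmin_le_cond.
pose W := \sum_i v i; have W0 : 0 <= W by apply: sumr_ge0 => i _; exact: ltW.
(* Half of the least slack (r - r1) v_i, since the perturbation has two parts: the one with [C] and
   the one with [C']. *)
pose e := (r - r1) * v1 / 2.
have e0 : 0 < e by rewrite divr_gt0 // mulr_gt0 // subr_gt0.
have CW0 : 0 < C * W + 1 by rewrite ltr_wpDl ?mulr_ge0.
have C'1 : 0 < C' + 1 by rewrite ltr_wpDl.
have [K1 K1P] : exists K, forall k, (K <= k)%N -> sigma ^+ k < e / (C * W + 1).
  by apply: geometric_small; [rewrite s1 ltW|rewrite divr_gt0].
(* The part with [C'] does not scale with t_k, so sigma^k must be small against r^k itself. *)
have [K2 K2P] : exists K, forall k, (K <= k)%N -> (sigma / r) ^+ k < e / (C' + 1).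
  apply: geometric_small; last by rewrite divr_gt0.
  rewrite ltr_pdivrMr // mul1r sr.
  by rewrite ltW ?divr_gt0.
pose K := maxn K1 K2.
(* The sum collects every ratio t_k(i) / (v_i r^k) up to time [K], which settles the base case; the
   1 gives m >= 1, used for the part with [C']. *)
pose m := 1 + \sum_(k < K.+1) \sum_i t k i / (v i * r ^+ k).
have m1 : 1 <= m.
  rewrite lerDl !sumr_ge0 // => k _; rewrite sumr_ge0 // => i _.
  by rewrite divr_ge0 // mulr_ge0 ?exprn_ge0 // ltW.
suff tm k i : t k i <= m * r ^+ k * v i.
  exists (m * (W + 1)) => [|k i]; first by rewrite mulr_gt0; lra.
  apply: le_trans (tm k i) _; rewrite mulrAC ler_wpM2r ?exprn_ge0 ?(ltW r0) //.
  rewrite ler_wpM2l; [by []|lra|].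
  rewrite /W (bigD1 i) //= -addrA lerDl addr_ge0 // sumr_ge0 // => j _.
  exact: ltW.
have base k' : (k' <= K)%N -> forall j, t k' j <= m * r ^+ k' * v j.
  move=> kK j; rewrite -mulrA [r ^+ _ * _]mulrC -ler_pdivrMr; last first.
    by rewrite mulr_gt0 ?exprn_gt0.
  rewrite /m -ltnS in kK *; rewrite (bigD1 (Ordinal kK)) //= (bigD1 j) //=.
  apply: ler_wpDl => //; rewrite -addrA lerDl !addr_ge0 ?sumr_ge0 // => [a _|a _].
    by rewrite divr_ge0 // mulr_ge0 ?exprn_ge0 // ltW.
  by rewrite sumr_ge0 // => b _; rewrite divr_ge0 // mulr_ge0 ?exprn_ge0 // ltW.
elim: k i => [|k IH] i; first exact: base.
have [kK|Kk] := leqP k.+1 K; first exact: base.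
rewrite ltnS in Kk; have K1k : (K1 <= k)%N by apply: leq_trans Kk; rewrite leq_maxl.
have K2k : (K2 <= k)%N by apply: leq_trans Kk; rewrite leq_maxr.
have rk : 0 < r ^+ k by rewrite exprn_gt0.
apply: le_trans (rec k i) _.
have A : \sum_j M i j * t k j <= m * r ^+ k * (r1 * v i).
  apply: le_trans (ler_wpM2l _ (Mv i)); last by rewrite mulr_ge0 ?exprn_ge0; lra.
  rewrite mulr_sumr; apply: ler_sum => j _.
  by rewrite mulrCA ler_wpM2l.
have B : \sum_j t k j <= m * r ^+ k * W.
  by rewrite /W mulr_sumr; apply: ler_sum => j _.
have mrk : 0 < m * r ^+ k by rewrite mulr_gt0 //; lra.
have sk0 : 0 < sigma ^+ k by rewrite exprn_gt0.
have B' : sigma ^+ k * (C * \sum_j t k j) <= m * r ^+ k * e.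
  apply: le_trans (_ : m * r ^+ k * (sigma ^+ k * (C * W + 1)) <= _).
    by move: (ler_wpM2l C0 B) => /(ler_wpM2l (ltW sk0)); nra.
  by rewrite ler_pM2l // -ler_pdivlMr // ltW // K1P.
have D : sigma ^+ k * C' <= m * r ^+ k * e.
  have := K2P k K2k; rewrite expr_div_n ltr_pdivrMr // mulrAC.
  rewrite ltr_pdivlMr // => F.
  have : e * r ^+ k <= m * r ^+ k * e by rewrite [leRHS]mulrC ler_pM2l // ler_peMl // ltW.
  nra.
have E : 2 * e <= (r - r1) * v i.
  have -> : 2 * e = (r - r1) * v1 by rewrite /e; field.
  by rewrite ler_wpM2l // subr_ge0 ltW.
rewrite exprSr mulrDr.
have := ler_wpM2l (ltW mrk) E; nra.
Qed.

End NonnegativeMatrices.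

(** * One step of the three errors, for abstract averaging and scaling matrices *)

Section OneStep.
Variables (R : realType) (m : nat).
Implicit Types a b v : 'cV[R]_m.
Variables (N : 'cV[R]_m -> R) (c d sigma : R).
Hypothesis N_norm : is_vector_norm N.
Hypotheses (c_gt0 : 0 < c) (d_gt0 : 0 < d).
Hypothesis norm2_leN : forall a, norm2 a <= c * N a.
Hypothesis N_le_norm2 : forall a, N a <= d * norm2 a.

Lemma vector_norm_ge0 a : 0 <= N a.
Proof. by rewrite -(pmulr_rge0 _ c_gt0) (le_trans (norm2_ge0 a)). Qed.

Lemma vector_normB a b : N (a - b) <= N a + N b.
Proof.
rewrite (le_trans (vector_normD N_norm _ _)) // lerD2l.
by rewrite -scaleN1r (vector_normZ N_norm) normrN1 mul1r.
Qed.

Variables (A P D S : 'M[R]_m) (W : nat -> 'M[R]_m).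
Variables (g : 'cV[R]_m -> 'cV[R]_m) (xs : 'cV[R]_m).
Variables (L l abar pa lambda y ytilde tau eps T : R).
Hypotheses (sigma01 : 0 < sigma < 1) (L_ge0 : 0 <= L) (l_ge0 : 0 <= l) (T_ge0 : 0 <= T).
Hypotheses (y_ge0 : 0 <= y) (ytilde_ge0 : 0 <= ytilde) (tau_ge0 : 0 <= tau) (eps_ge0 : 0 <= eps).
Hypotheses (pa_ge0 : 0 <= pa) (pa_le : pa <= abar).
Hypotheses (AP : A *m P = P) (PA : P *m A = P).
Hypothesis A_contracts : forall a, N (A *m a - P *m a) <= sigma * N (a - P *m a).
Hypothesis PDP : P *m D *m P = pa *: P.
Hypothesis D_le : forall v, norm2 (D *m v) <= abar * norm2 v.
Hypothesis P_le : forall v, norm2 (P *m v) <= y * norm2 v.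
Hypothesis S_le : forall v, norm2 (S *m v) <= L * norm2 v.
Hypothesis A1_le : forall v, norm2 (A *m v - v) <= tau * norm2 v.
Hypothesis P1_le : forall v, norm2 (v - P *m v) <= eps * norm2 v.
Hypothesis W0 : W 0 = 1%:M.
Hypothesis W_le : forall k v, norm2 (W k *m v) <= ytilde * norm2 v.
Hypothesis PW_cvg : forall k v,
  norm2 (P *m (W k *m v) - S *m v) <= T * sigma ^+ k * norm2 v.
Hypothesis W_cauchy : forall k v,
  norm2 (W k.+1 *m v - W k *m v) <= T * sigma ^+ k * norm2 v.
Hypothesis g_lip : forall a b, norm2 (g a - g b) <= l * norm2 (a - b).
Hypothesis Sg0 : S *m g xs = 0.
Hypothesis gradient_step : forall a,
  norm2 (P *m a - xs - pa *: (S *m g (P *m a))) <= lambda * norm2 (P *m a - xs).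

Variables (x z : nat -> 'cV[R]_m).
Hypothesis z0 : z 0 = g (x 0).
Hypothesis xS : forall k, x k.+1 = A *m x k - D *m z k.
Hypothesis zS : forall k,
  z k.+1 = A *m z k + W k.+1 *m g (x k.+1) - W k *m g (x k).

Definition consensus_error k := N (x k - P *m x k).
Definition optimality_error k := norm2 (P *m x k - xs).
Definition tracking_error k := N (z k - P *m z k).

Let t1 := consensus_error.
Let t2 := optimality_error.
Let t3 := tracking_error.
Let s k := norm2 (g (x k)).
(** The bound on |z_k| proved in [tracker_le]; multiplied by [abar] it produces the [abar] terms in
    the first and third rows of [J]. *)
Let zeta k := c * t3 k + L * l * (c * t1 k + t2 k) + T * sigma ^+ k * s k.

(* Conserved by the recursion because [P A = P]. *)
Lemma tracked_average k : P *m z k = P *m (W k *m g (x k)).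
Proof.
elim: k => [|k IH]; first by rewrite z0 W0 mul1mx.
by rewrite zS mulmxBr mulmxDr (mulmxA P A) PA IH addrAC subrr add0r.
Qed.

Lemma distance_le k : norm2 (x k - xs) <= c * t1 k + t2 k.
Proof.
by rewrite (le_trans (norm2_dist _ (P *m x k) _)) // lerD // norm2_leN.
Qed.

Lemma gradient_le k : s k <= l * (c * t1 k + t2 k) + norm2 (g xs).
Proof.
rewrite /s -{1}(subrK (g xs) (g (x k))) (le_trans (norm2D _ _)) // lerD2r.
by rewrite (le_trans (g_lip _ _)) // ler_wpM2l // distance_le.
Qed.

(** z_k is its deviation from P z_k, plus P W_k g(x_k) with P W_k replaced by its limit S, plus the
    replacement error. Since S g vanishes at [xs], the middle term is controlled by the distance
    from x_k to [xs]. *)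
Lemma tracker_le k : norm2 (z k) <= zeta k.
Proof.
rewrite -{1}(subrK (P *m z k) (z k)) (le_trans (norm2D _ _)) // /zeta -addrA.
apply: lerD; first exact: norm2_leN.
rewrite tracked_average -(subrK (S *m g (x k)) (P *m (W k *m g (x k)))) addrC.
apply: le_trans (norm2D _ _) _; apply: lerD; first exact: PW_cvg.
rewrite -[S *m _]subr0 -Sg0 -mulmxBr (le_trans (S_le _)) // -mulrA ler_wpM2l //.
by rewrite (le_trans (g_lip _ _)) // ler_wpM2l // distance_le.
Qed.

Lemma step_size_tracker_le k : norm2 (D *m z k) <= abar * zeta k.
Proof.
by rewrite (le_trans (D_le _)) // ler_wpM2l ?tracker_le // (le_trans pa_ge0).
Qed.

Lemma consensus_error_step k :
  t1 k.+1 <= sigma * t1 k + d * eps * (abar * zeta k).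
Proof.
have -> : t1 k.+1 = N (A *m x k - P *m x k - (D *m z k - P *m (D *m z k))).
  rewrite /t1 /consensus_error xS mulmxBr (mulmxA P A) PA.
  by congr N; rewrite !opprB addrACA [RHS]addrACA -!addrA; do 2!congr (_ + _); rewrite addrC.
apply: le_trans (vector_normB _ _) _; apply: lerD; first exact: A_contracts.
apply: le_trans (N_le_norm2 _) _; rewrite -mulrA ler_pM2l //.
apply: le_trans (P1_le _) _; rewrite ler_wpM2l //.
exact: step_size_tracker_le.
Qed.

Lemma optimality_error_step k :
  t2 k.+1 <= lambda * t2 k + abar * (L * l * (c * t1 k))
             + abar * (T * sigma ^+ k * s k) + y * (abar * (c * t3 k)).
Proof.
have abar0 : 0 <= abar by exact: le_trans pa_le.
(* [u1] is an exact gradient step at the average, [u2] the effect of evaluating gradients at x_k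
   instead of P x_k, [u3] the lag of P W_k behind S, and [u4] the deviation of z_k from its average,
   scaled by the step-sizes. *)
pose u1 := P *m x k - xs - pa *: (S *m g (P *m x k)).
pose u2 := S *m (g (P *m x k) - g (x k)).
pose u3 := P *m (W k *m g (x k)) - S *m g (x k).
pose u4 := D *m (z k - P *m z k).
have -> : t2 k.+1 = norm2 (u1 + pa *: u2 - pa *: u3 - P *m u4).
  rewrite /t2 /optimality_error; congr norm2.
  have -> : P *m x k.+1 = P *m x k - P *m u4 - pa *: (P *m z k).
    rewrite /u4 xS mulmxBr (mulmxA P A) PA -!addrA; congr (_ + _).
    rewrite -opprD; congr (- _); rewrite !mulmxBr !mulmxA PDP -scalemxAl.
    by rewrite subrK.
  rewrite tracked_average /u1 /u2 /u3 mulmxBr !scalerBr.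
  move: (P *m u4) (pa *: _) (pa *: _) (pa *: _) => e f h q.
  apply/colP => i; rewrite !mxE; ring.
apply: le_trans (norm2B _ _) _; apply: lerD; last first.
  rewrite (le_trans (P_le _)) // ler_wpM2l // (le_trans (D_le _)) //.
  by rewrite ler_wpM2l // norm2_leN.
have pa_scale v : norm2 (pa *: v) <= abar * norm2 v.
  by rewrite norm2Z ger0_norm // ler_wpM2r // norm2_ge0.
apply: le_trans (norm2B _ _) _; apply: lerD; last first.
  by rewrite (le_trans (pa_scale _)) // ler_wpM2l // PW_cvg.
apply: le_trans (norm2D _ _) _; apply: lerD; first exact: gradient_step.
rewrite (le_trans (pa_scale _)) // ler_wpM2l // (le_trans (S_le _)) //.
rewrite -mulrA ler_wpM2l // (le_trans (g_lip _ _)) // ler_wpM2l //.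
by rewrite -norm2N opprB norm2_leN.
Qed.

Lemma tracking_error_step k :
  t3 k.+1 <= sigma * t3 k + d * eps *
    (ytilde * (l * (tau * (c * t1 k) + abar * zeta k)) + T * sigma ^+ k * s k).
Proof.
pose u := W k.+1 *m g (x k.+1) - W k *m g (x k).
have -> : t3 k.+1 = N (A *m z k - P *m z k + (u - P *m u)).
  have zE : z k.+1 = A *m z k + u by rewrite zS -addrA.
  rewrite /t3 /tracking_error zE mulmxDr (mulmxA P A) PA.
  by congr N; rewrite opprD addrACA.
apply: le_trans (vector_normD N_norm _ _) _; apply: lerD; first exact: A_contracts.
apply: le_trans (N_le_norm2 _) _; rewrite -mulrA ler_pM2l //.
apply: le_trans (P1_le _) _; rewrite ler_wpM2l //.
(* Splitting at W_(k+1) g(x_k) separates the motion of the iterate from the change of the scaling,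
   which decays like sigma^k. *)
have -> : u = W k.+1 *m (g (x k.+1) - g (x k)) + (W k.+1 *m g (x k) - W k *m g (x k)).
  by rewrite mulmxBr addrA subrK.
apply: le_trans (norm2D _ _) _; apply: lerD; last exact: W_cauchy.
rewrite (le_trans (W_le _ _)) // ler_wpM2l // (le_trans (g_lip _ _)) // ler_wpM2l //.
(* Since A P = P, the matrix A - I annihilates P x_k; only the consensus error is multiplied by
   [tau]. *)
have -> : x k.+1 - x k = A *m (x k - P *m x k) - (x k - P *m x k) - D *m z k.
  by rewrite xS mulmxBr (mulmxA A P) AP opprB addrA subrK addrAC.
apply: le_trans (norm2B _ _) _; apply: lerD; last exact: step_size_tracker_le.
by rewrite (le_trans (A1_le _)) // ler_wpM2l // norm2_leN.
Qed.

Lemma iterate_error_le k : N (x k - xs) <= t1 k + d * t2 k.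
Proof.
rewrite -{1}(subrK (P *m x k) (x k)) -addrA.
by rewrite (le_trans (vector_normD N_norm _ _)) // lerD // N_le_norm2.
Qed.

Let a1 := c * d * eps * L * l.
Let a2 := d * eps * L * l.
Let a3 := c * d * eps.
Let a4 := c * L * l.
Let a5 := y * c.
Let a6 := eps * ytilde * l * tau * c * d.
Let a7 := c * d * L * l ^+ 2 * eps * ytilde.
Let a8 := d * L * l ^+ 2 * eps * ytilde.
Let a9 := c * d * eps * l * ytilde.
Let J := mx_of_rows 3
  [:: [:: sigma + a1 * abar; a2 * abar; a3 * abar ];
      [:: a4 * abar;         lambda;    a5 * abar ];
      [:: a6 + a7 * abar;    a8 * abar; sigma + a9 * abar ]].

Hypothesis lambda_ge0 : 0 <= lambda.

Let sigma_ge0 : 0 <= sigma. Proof. by case/andP: sigma01 => /ltW. Qed.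
Let c_ge0 : 0 <= c. Proof. exact: ltW. Qed.
Let d_ge0 : 0 <= d. Proof. exact: ltW. Qed.
Let abar_ge0 : 0 <= abar. Proof. exact: le_trans pa_le. Qed.

Let J_ge0 i j : 0 <= J i j.
Proof.
rewrite mxE; case: i j => [[|[|[|//]]] i3] [[|[|[|//]]] j3] //=;
  rewrite /a1 /a2 /a3 /a4 /a5 /a6 /a7 /a8 /a9;
  by rewrite ?(mulr_ge0, addr_ge0, exprn_ge0).
Qed.

Let t k (i : 'I_3) := nth 0 [:: t1 k; t2 k; t3 k] i.

Let t_ge0 k i : 0 <= t k i.
Proof.
by rewrite /t; case: i => [[|[|[|//]]] i3] /=; rewrite ?norm2_ge0 ?vector_norm_ge0.
Qed.

Lemma error_recursion : exists C C', [/\ 0 <= C, 0 <= C' & forall k i,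
  t k.+1 i <= \sum_j J i j * t k j + sigma ^+ k * (C * \sum_j t k j + C')].
Proof.
(* The coefficients of sigma^k |g(x_k)| in the three rows: through [zeta], directly, and both ways.
   Their sum [Q] serves all rows, and [gradient_le] converts |g(x_k)| into errors. *)
pose Q1 := d * eps * (abar * T); pose Q2 := abar * T.
pose Q3 := d * eps * (ytilde * (l * (abar * T)) + T).
have Q1_ge0 : 0 <= Q1 by rewrite /Q1 !mulr_ge0.
have Q2_ge0 : 0 <= Q2 by rewrite /Q2 mulr_ge0.
have Q3_ge0 : 0 <= Q3 by rewrite /Q3 !(mulr_ge0, addr_ge0).
pose Q := Q1 + Q2 + Q3; have Q_ge0 : 0 <= Q by rewrite /Q !addr_ge0.
have Q1Q : Q1 <= Q by rewrite /Q -addrA lerDl addr_ge0.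
have Q2Q : Q2 <= Q by rewrite /Q addrAC lerDr addr_ge0.
have Q3Q : Q3 <= Q by rewrite /Q lerDr addr_ge0.
exists (Q * (l * (c + 1))), (Q * norm2 (g xs)); split.
- by rewrite !mulr_ge0 // addr_ge0.
- by rewrite mulr_ge0 ?norm2_ge0.
move=> k i; rewrite !big_ord_recl !big_ord0 !addr0.
have := t_ge0 k ord0; have := t_ge0 k (lift ord0 ord0).
have := t_ge0 k (lift ord0 (lift ord0 ord0)).
have := consensus_error_step k; have := optimality_error_step k.
have := tracking_error_step k; have := gradient_le k.
have := exprn_ge0 k sigma_ge0; have : 0 <= s k by exact: norm2_ge0.
rewrite /t /J !mxE /= -/t1 -/t2 -/t3 /zeta.
move: (t1 k) (t2 k) (t3 k) (s k) (norm2 (g xs)) (sigma ^+ k) => u1 u2 u3 sk G q.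
move=> sk0 q0 sk_le step3 step2 step1 u30 u20 u10.
have residual q' : 0 <= q' -> q' <= Q ->
    q' * q * sk <= q * (Q * (l * (c + 1)) * (u1 + (u2 + u3)) + Q * G).
  move=> q'0 q'Q; rewrite (_ : q' * q * sk = q * (q' * sk)); last by ring.
  rewrite ler_wpM2l // (le_trans (ler_wpM2r sk0 q'Q)) // -(mulrA Q) -mulrDr ler_wpM2l //.
  rewrite (le_trans sk_le) // lerD2r -mulrA ler_wpM2l //.
  have := mulr_ge0 c_ge0 u20; have := mulr_ge0 c_ge0 u30; lra.
have r1 := residual Q1 Q1_ge0 Q1Q; have r2 := residual Q2 Q2_ge0 Q2Q.
have r3 := residual Q3 Q3_ge0 Q3Q.
move: r1 r2 r3; move: (q * (_ + _)) => r r1 r2 r3.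
case: i => [[|[|[|//]]] i3] /=.
- move: r1; rewrite /Q1 /a1 /a2 /a3; lra.
- move: r2; rewrite /Q2 /a4 /a5; lra.
- move: r3; rewrite /Q3 /a6 /a7 /a8 /a9; lra.
Qed.

Lemma geometric_error_decay xi : 0 < xi -> exists2 m, 0 < m & forall k,
  N (x k - xs) <= m * (Num.max (spectral_radius J) sigma + xi) ^+ k.
Proof.
move=> xi0; have [C [C' [C0 C'0 rec]]] := error_recursion.
set r := Num.max _ _ + xi.
have Jr : spectral_radius J < r by rewrite ltr_pwDr // le_max lexx.
have sr : sigma < r by rewrite ltr_pwDr // le_max lexx orbT.
have [C1 C10 tC1] := perturbed_linear_recursion sigma01 sr C0 C'0 J_ge0 t_ge0 Jr rec.
exists (C1 * (1 + d)) => [|k]; first by rewrite mulr_gt0 // addr_gt0.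
apply: le_trans (iterate_error_le k) _.
have := tC1 k ord0; have := ler_wpM2l d_ge0 (tC1 k (lift ord0 ord0)).
rewrite /t /=; lra.
Qed.

End OneStep.

(** * Kronecker products acting block by block on stacked vectors *)

Section Blocks.
Variables (R : realType) (n p : nat).

Lemma blockE (x : 'cV[R]_(n * p)) i j : block x i j 0 = x (mxtens_index (i, j)) 0.
Proof. by rewrite mxE. Qed.

Lemma block_inj (x y : 'cV[R]_(n * p)) : (forall i, block x i = block y i) -> x = y.
Proof.
move=> xy; apply/colP => u; rewrite -(mxtens_unindexK u).
by case: (mxtens_unindex u) => i j; rewrite -!blockE xy.
Qed.

Lemma blockB (x y : 'cV[R]_(n * p)) i : block (x - y) i = block x i - block y i.
Proof. by apply/colP => j; rewrite !mxE. Qed.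

Lemma blockZ (t : R) (x : 'cV[R]_(n * p)) i : block (t *: x) i = t *: block x i.
Proof. by apply/colP => j; rewrite !mxE. Qed.

Lemma block_stack (v : 'I_n -> 'cV[R]_p) i : block (stack v) i = v i.
Proof. by apply/colP => j; rewrite !mxE mxtens_indexK. Qed.

Lemma block_consensus (w : 'cV[R]_p) i : block (consensus n w) i = w.
Proof.
apply/colP => j; rewrite blockE.
have := tensmxE (const_mx 1 : 'cV[R]_n) w i j 0 0; rewrite [const_mx _ _ _]mxE mul1r => <-.
(* The Kronecker product has 1 * 1 columns; its only column index has to be identified with 0. *)
by congr (_ _ _); apply: val_inj.
Qed.

Lemma sum_mxtens (F : 'I_(n * p) -> R) :
  \sum_u F u = \sum_i \sum_j F (mxtens_index (i, j)).
Proof.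
rewrite pair_bigA /= (reindex (@mxtens_index n p)) /=; first by apply: eq_bigr => -[].
by exists (@mxtens_unindex n p) => u _; rewrite ?mxtens_indexK ?mxtens_unindexK.
Qed.

Lemma norm2_blocks (x : 'cV[R]_(n * p)) : norm2 x ^+ 2 = \sum_i norm2 (block x i) ^+ 2.
Proof.
rewrite norm2_sqr dotE sum_mxtens; apply: eq_bigr => i _.
by rewrite norm2_sqr dotE; apply: eq_bigr => j _; rewrite blockE.
Qed.

Lemma norm2_le_blocks (C : R) (x y : 'cV[R]_(n * p)) : 0 <= C ->
  (forall i, norm2 (block x i) <= C * norm2 (block y i)) -> norm2 x <= C * norm2 y.
Proof.
move=> C0 xy; rewrite -(ler_pXn2r (n := 2)) ?nnegrE ?mulr_ge0 ?norm2_ge0 //.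
rewrite exprMn !norm2_blocks mulr_sumr; apply: ler_sum => i _.
by rewrite -exprMn ler_pXn2r ?nnegrE ?mulr_ge0 ?norm2_ge0.
Qed.

Lemma kronIE (M : 'M[R]_n) i i' j j' :
  kronI p M (mxtens_index (i, j)) (mxtens_index (i', j')) = M i i' * (j == j')%:R.
Proof. by rewrite tensmxE !mxE. Qed.

Lemma block_kronI (M : 'M[R]_n) (x : 'cV[R]_(n * p)) i :
  block (kronI p M *m x) i = \sum_j M i j *: block x j.
Proof.
apply/colP => k; rewrite blockE mxE sum_mxtens summxE; apply: eq_bigr => j _.
rewrite !mxE (bigD1 k) //= big1 ?addr0 => [|k' k'k].
  by rewrite kronIE eqxx mulr1.
by rewrite kronIE eq_sym (negPf k'k) mulr0 mul0r.
Qed.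

Lemma kronI_mul (M M' : 'M[R]_n) : kronI p M *m kronI p M' = kronI p (M *m M').
Proof. by rewrite /kronI tensmx_mul mul1mx. Qed.

Lemma kronIZ (t : R) (M : 'M[R]_n) : kronI p (t *: M) = t *: kronI p M.
Proof. by apply/matrixP => u v; rewrite !mxE mulrA. Qed.

Lemma kronI1 : kronI p 1%:M = 1%:M :> 'M[R]_(n * p).
Proof.
apply/matrixP => u v; rewrite -(mxtens_unindexK u) -(mxtens_unindexK v).
move: (mxtens_unindex u) (mxtens_unindex v) => [i j] [i' j'].
rewrite kronIE !mxE.
have -> : (mxtens_index (i, j) == mxtens_index (i', j')) = ((i, j) == (i', j')).
  exact: (can_eq (@mxtens_indexK n p)).
rewrite xpair_eqE.
by case: (i == i'); rewrite ?mul1r ?mul0r.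
Qed.

Lemma norm2_kron_diag (a : 'cV[R]_n) (C : R) (x : 'cV[R]_(n * p)) : 0 <= C ->
  (forall i, `|a i 0| <= C) -> norm2 (kronI p (diag_mx a^T) *m x) <= C * norm2 x.
Proof.
move=> C0 aC; apply: norm2_le_blocks => // i; rewrite block_kronI.
rewrite (bigD1 i) //= big1 ?addr0 => [|j ji]; last first.
  by rewrite !mxE eq_sym (negPf ji) mulr0n scale0r.
by rewrite !mxE eqxx mulr1n norm2Z ler_wpM2r ?norm2_ge0.
Qed.

Lemma kron_ones (x : 'cV[R]_(n * p)) :
  kronI p (const_mx 1) *m x = consensus n (\sum_j block x j).
Proof.
apply: block_inj => i; rewrite block_kronI block_consensus.
by apply: eq_bigr => j _; rewrite mxE scale1r.
Qed.

(** One factor sqrt n comes from the n equal blocks of the image, the other from Cauchy-Schwarz on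
    the block norms. This is the source of the n in a1, a2, a4, a7 and a8. *)
Lemma norm2_kron_ones (x : 'cV[R]_(n * p)) :
  norm2 (kronI p (const_mx 1) *m x) <= n%:R * norm2 x.
Proof.
rewrite -(ler_pXn2r (n := 2)) ?nnegrE ?mulr_ge0 ?norm2_ge0 //.
rewrite kron_ones norm2_blocks.
under eq_bigr do rewrite block_consensus.
rewrite sumr_const card_ord -[_ *+ n]mulr_natl exprMn [n%:R ^+ 2]expr2 -mulrA ler_wpM2l //.
pose u : 'cV[R]_n := const_mx 1; pose v : 'cV[R]_n := \col_j norm2 (block x j).
have vv : norm2 v ^+ 2 = norm2 x ^+ 2.
  by rewrite norm2_blocks norm2_sqr dotE; apply: eq_bigr => j _; rewrite mxE expr2.
have uu : norm2 u ^+ 2 = n%:R.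
  rewrite norm2_sqr dotE; under eq_bigr do rewrite !mxE mulr1.
  by rewrite sumr_const card_ord.
rewrite -vv -uu -exprMn.
rewrite ler_pXn2r ?nnegrE ?mulr_ge0 ?norm2_ge0 //.
apply: le_trans (norm2_sum _) _; apply: le_trans (Cauchy_Schwarz _ _).
by rewrite dotE; apply: ler_sum => j _; rewrite !mxE mul1r.
Qed.

Lemma norm2_consensus_le (C : R) (w w' : 'cV[R]_p) : 0 <= C ->
  norm2 w <= C * norm2 w' -> norm2 (consensus n w) <= C * norm2 (consensus n w').
Proof. by move=> C0 ww'; apply: norm2_le_blocks => // i; rewrite !block_consensus. Qed.

Lemma consensusB (w w' : 'cV[R]_p) : consensus n (w - w') = consensus n w - consensus n w'.
Proof. by apply: block_inj => i; rewrite blockB !block_consensus. Qed.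

Lemma consensusZ t (w : 'cV[R]_p) : consensus n (t *: w) = t *: consensus n w.
Proof. by apply: block_inj => i; rewrite blockZ !block_consensus. Qed.

Lemma stacked_gradient_lipschitz (l : R) (f : 'I_n -> 'cV[R]_p -> R) : 0 <= l ->
  (forall i, lipschitz_gradient l (f i)) -> forall a b,
  norm2 (stacked_gradient f a - stacked_gradient f b) <= l * norm2 (a - b).
Proof.
move=> l0 fl a b; apply: norm2_le_blocks => // i.
by rewrite !blockB !block_stack; exact: fl.
Qed.

Lemma norm2_diag (a : 'I_(n * p) -> R) (C : R) (x : 'cV[R]_(n * p)) : 0 <= C ->
  (forall i, `|a i| <= C) -> norm2 (diag_mx (\row_i a i) *m x) <= C * norm2 x.
Proof.
move=> C0 aC; rewrite -(ler_pXn2r (n := 2)) ?nnegrE ?mulr_ge0 ?norm2_ge0 //.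
rewrite exprMn !norm2_sqr !dotE mulr_sumr; apply: ler_sum => i _.
rewrite mul_diag_mx !mxE -!expr2 exprMn ler_wpM2r ?sqr_ge0 //.
by rewrite -[a i ^+ 2]real_normK ?num_real // ler_pXn2r ?nnegrE.
Qed.

End Blocks.

(** * The sum of the objectives, with parameters n mu and n l *)

Section SumOfObjectives.
Variables (R : realType) (n p : nat) (f : 'I_n -> 'cV[R]_p -> R) (l mu : R).
Hypotheses (n_gt0 : (0 < n)%N) (l_gt0 : 0 < l) (mu_gt0 : 0 < mu).
Hypothesis f_lip : forall i, lipschitz_gradient l (f i).
Hypothesis f_convex : forall i, strongly_convex mu (f i).

Let F x := \sum_i f i x.
(** The sum of the gradients rather than the gradient of [F]: the summed convexity inequalities tie
    it to [F], which is the form in which the descent lemmas take it. *)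
Let G x := \sum_i gradient (f i) x.

Lemma sum_strongly_convex x y :
  F x + dot (G x) (y - x) + n%:R * mu / 2 * norm2 (x - y) ^+ 2 <= F y.
Proof.
have -> : dot (G x) (y - x) = \sum_i dot (gradient (f i) x) (y - x).
  by rewrite /dot /G linear_sum /= mulmx_suml summxE.
have -> : n%:R * mu / 2 * norm2 (x - y) ^+ 2 = \sum_(i < n) (mu / 2 * norm2 (x - y) ^+ 2).
  by rewrite sumr_const card_ord -[RHS]mulr_natl !mulrA.
by rewrite /F -!big_split; apply: ler_sum => i _; exact: f_convex.
Qed.

Lemma sum_lipschitz_gradient x y : norm2 (G x - G y) <= n%:R * l * norm2 (x - y).
Proof.
rewrite /G -sumrB (le_trans (norm2_sum _)) //.
have -> : n%:R * l * norm2 (x - y) = \sum_(i < n) (l * norm2 (x - y)).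
  by rewrite sumr_const card_ord -[RHS]mulr_natl mulrA.
by apply: ler_sum => i _; exact: f_lip.
Qed.

Variable xstar : 'cV[R]_p.
Hypothesis xstar_min : forall x, average f xstar <= average f x.

Let nl_gt0 : 0 < n%:R * l. Proof. by rewrite mulr_gt0 ?ltr0n. Qed.
Let nmu_gt0 : 0 < n%:R * mu. Proof. by rewrite mulr_gt0 ?ltr0n. Qed.

Lemma sum_gradient_eq0 : G xstar = 0.
Proof.
apply: (minimizer_gradient_eq0 nmu_gt0 nl_gt0 sum_strongly_convex sum_lipschitz_gradient).
by move=> y; rewrite -(ler_pM2l (x := n%:R^-1)) ?invr_gt0 ?ltr0n //; exact: xstar_min.
Qed.

Lemma sum_gradient_step eta x : 0 <= eta -> eta * (n%:R * l) < 1 ->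
  norm2 (x - xstar - eta *: G x) <= `|1 - n%:R * eta * mu| * norm2 (x - xstar).
Proof.
move=> eta0 etal.
have := gradient_step_contraction nmu_gt0 sum_strongly_convex
  sum_lipschitz_gradient xstar x eta0 etal.
by rewrite sum_gradient_eq0 subr0 [n%:R * eta]mulrC -mulrA.
Qed.

End SumOfObjectives.

(** * Convergence of the powers of the weight matrix and of their inverse diagonals *)

Section Weights.
Variables (R : realType) (n p : nat) (A : 'M[R]_n) (pi_r : 'cV[R]_n).
Hypotheses (A_stoch : row_stochastic A) (A_diag : forall i, 0 < A i i).
Hypothesis pi_perron : left_perron A pi_r.

Let P := Yinf p pi_r.
Let PiE i j : ((const_mx 1 : 'cV[R]_n) *m pi_r^T) i j = pi_r j 0.
Proof. by rewrite mxE big_ord1 !mxE mul1r. Qed.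

Lemma kronA_Yinf : kronI p A *m P = P.
Proof.
rewrite /P /Yinf kronI_mul mulmxA; congr (kronI p (_ *m _)).
apply/colP => i; rewrite !mxE -[RHS](A_stoch.2 i).
by apply: eq_bigr => j _; rewrite mxE mulr1.
Qed.

Lemma Yinf_kronA : P *m kronI p A = P.
Proof.
by case: pi_perron => _ piA _; rewrite /P /Yinf kronI_mul -mulmxA piA.
Qed.

(** Up to the Kronecker factor [Yinf] has rank one, so it sees [M] only through pi_r^T M 1; for the
    diagonal of step-sizes this is pi_r^T alpha. *)
Lemma Yinf_kron_Yinf (M : 'M[R]_n) : P *m kronI p M *m P =
  (pi_r^T *m M *m (const_mx 1 : 'cV_n)) 0 0 *: P.
Proof.
rewrite /P /Yinf !kronI_mul -kronIZ !mulmxA; congr (kronI p _).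
rewrite -!(mulmxA (const_mx 1)) mulmxA.
by rewrite [X in _ *m X *m _]mx11_scalar mul_mx_scalar scalemxAl.
Qed.

Lemma YS k : Y p A k.+1 = kronI p A *m Y p A k.
Proof. by rewrite kronI_mul. Qed.

Lemma Yinf_Y k : P *m Y p A k = P.
Proof.
elim: k => [|k IH]; first by rewrite /Y kronI1 mulmx1.
by rewrite YS mulmxA Yinf_kronA.
Qed.

Lemma iter_ge0 k i j : 0 <= iter k (mulmx A) 1%:M i j.
Proof.
elim: k i j => [|k IH] i j /=; first by rewrite mxE ler0n.
by rewrite mxE; apply: sumr_ge0 => h _; rewrite mulr_ge0 //; exact: A_stoch.1.
Qed.

(** The self-loop alone gives (A^(k+1))_ii >= A_ii (A^k)_ii > 0. *)
Lemma Y_diag_gt0 k u : 0 < Y p A k u u.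
Proof.
rewrite -(mxtens_unindexK u); case: (mxtens_unindex u) => i j.
rewrite kronIE eqxx mulr1; elim: k => [|k IH] /=; first by rewrite mxE eqxx ltr01.
rewrite mxE (bigD1 i) //= ltr_wpDr ?mulr_gt0 //; apply: sumr_ge0 => h _.
by rewrite mulr_ge0 ?iter_ge0 //; exact: A_stoch.1.
Qed.

Lemma Yinf_diag_gt0 u : 0 < P u u.
Proof.
rewrite -(mxtens_unindexK u); case: (mxtens_unindex u) => i j.
by rewrite kronIE eqxx mulr1 PiE; case: pi_perron.
Qed.

Lemma invmx_Ytilde k :
  invmx (Ytilde p A k) = diag_mx (\row_u (Y p A k u u)^-1).
Proof.
have YW : Ytilde p A k *m diag_mx (\row_u (Y p A k u u)^-1) = 1%:M.
  rewrite mulmx_diag -diag_const_mx; congr diag_mx; apply/rowP => u.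
  rewrite [LHS]mxE [RHS]mxE [X in X * _]mxE [X in _ * X]mxE.
  by rewrite divff // gt_eqF // Y_diag_gt0.
have [YU _] := mulmx1_unit YW.
by rewrite -[LHS]mulmx1 -YW mulKmx.
Qed.

(** Each column of 1 pi_r^T is constant and equal to its own diagonal entry, so scaling by the
    inverse diagonal leaves ones. *)
Lemma Yinf_diag_inv : P *m diag_mx (\row_u (P u u)^-1) = kronI p (const_mx 1).
Proof.
apply/matrixP => u v; rewrite mul_mx_diag [LHS]mxE [(\row__ _) _ _]mxE.
rewrite -(mxtens_unindexK u) -(mxtens_unindexK v).
move: (mxtens_unindex u) (mxtens_unindex v) => [i j] [i' j'].
rewrite !kronIE !PiE eqxx mulr1 mxE mul1r mulrAC divff ?mul1r //.
by case: pi_perron => pi0 _ _; rewrite gt_eqF.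
Qed.

Variables (N : 'cV[R]_(n * p) -> R) (sigma c d : R).
Hypotheses (sigma01 : 0 < sigma < 1) (c_gt0 : 0 < c) (d_gt0 : 0 < d).
Hypothesis A_contracts : forall a,
  N (kronI p A *m a - P *m a) <= sigma * N (a - P *m a).
Hypothesis norm2_leN : forall a, norm2 a <= c * N a.
Hypothesis N_le_norm2 : forall a, N a <= d * norm2 a.

Let sigma_ge0 : 0 <= sigma. Proof. by case/andP: sigma01 => /ltW. Qed.
Let eps := spectral_norm (1%:M - P).
Let T0 := c * d * eps.

Let T0_ge0 : 0 <= T0.
Proof. by rewrite /T0 !mulr_ge0 ?spectral_norm_ge0 ?ltW. Qed.

(** Because P Y_k = P, the contraction in [N] can be iterated; passing to [N] and back costs d and
    c, and the initial deviation costs [eps], whence [T0]. *)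
Lemma Y_cvg k v : norm2 (Y p A k *m v - P *m v) <= T0 * sigma ^+ k * norm2 v.
Proof.
have NY : N (Y p A k *m v - P *m v) <= sigma ^+ k * N (v - P *m v).
  elim: k => [|k IH]; first by rewrite /Y kronI1 mul1mx mul1r.
  rewrite YS -mulmxA exprS -mulrA -{1}(Yinf_Y k) -mulmxA.
  apply: le_trans (A_contracts _) _; rewrite ler_wpM2l //.
  by rewrite mulmxA Yinf_Y.
apply: le_trans (norm2_leN _) _; rewrite /T0 -!mulrA ler_pM2l //.
apply: le_trans NY _; rewrite [eps * _]mulrCA [d * _]mulrCA.
rewrite ler_wpM2l ?exprn_ge0 //; apply: le_trans (N_le_norm2 _) _.
rewrite ler_pM2l // -{1}[v]mul1mx -mulmxBl; exact: norm2_mulmx.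
Qed.

Lemma Y_diag_cvg k u : `|Y p A k u u - P u u| <= T0 * sigma ^+ k.
Proof.
pose e : 'cV[R]_(n * p) := delta_mx u 0.
have e1 : norm2 e = 1.
  apply/eqP; rewrite -(eqrXn2 (n := 2)) ?norm2_ge0 // norm2_sqr dotE.
  rewrite (bigD1 u) //= big1 ?addr0 ?mxE ?eqxx ?mulr1 ?expr1n // => v vu.
  by rewrite !mxE (negPf vu) mul0r.
have := Y_cvg k e; rewrite e1 mulr1; apply: le_trans.
apply: le_trans (norm2_coord _ u).
by rewrite -!colE !mxE.
Qed.

(** Late diagonals lie within half the least entry of the limit diagonal, and the early ones are
    finitely many positive numbers. Away from 0 inversion is Lipschitz, so the inverse diagonals
    inherit the rate [sigma]. *)
Lemma Y_diag_lower_bound : exists2 w, 0 < w & forall k u, w <= Y p A k u u /\ w <= P u u.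
Proof.
pose w1 := \big[Num.min/1]_u P u u.
have w1_gt0 : 0 < w1 by apply: lt_bigmin => // u _; exact: Yinf_diag_gt0.
have T1 : 0 < T0 + 1 by rewrite ltr_wpDl.
have [K KP] : exists K, forall k, (K <= k)%N -> sigma ^+ k < w1 / 2 / (T0 + 1).
  apply: geometric_small; last by rewrite !divr_gt0.
  by case/andP: sigma01 => /ltW -> ->.
pose w2 := \big[Num.min/1]_(k < K) \big[Num.min/1]_u Y p A k u u.
have w2_gt0 : 0 < w2.
  by do 2![apply: lt_bigmin => // ? _]; exact: Y_diag_gt0.
have w1P u : w1 <= P u u by exact: bigmin_le_cond.
exists (Num.min (w1 / 2) w2) => [|k u]; first by rewrite lt_min divr_gt0.
split; last by rewrite ge_min; apply/orP; left; have := w1P u; lra.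
rewrite ge_min; have [Kk|kK] := leqP K k; last first.
  apply/orP; right; apply: le_trans (_ : \big[Num.min/1]_u Y p A k u u <= _).
    exact: (bigmin_le_cond _ (j := Ordinal kK)).
  exact: bigmin_le_cond.
apply/orP; left; have := Y_diag_cvg k u.
have := KP k Kk; rewrite ltr_pdivlMr // mulrC => A1.
rewrite ler_norml => /andP[B _]; have := w1P u.
have : 0 <= sigma ^+ k by rewrite exprn_ge0.
lra.
Qed.

Lemma invmx_Ytilde_le : exists2 C, 0 <= C &
  forall k v, norm2 (invmx (Ytilde p A k) *m v) <= C * norm2 v.
Proof.
have [w w0 wP] := Y_diag_lower_bound.
exists w^-1 => [|k v]; first by rewrite invr_ge0 ltW.
rewrite invmx_Ytilde; apply: norm2_diag => [|u]; first by rewrite invr_ge0 ltW.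
rewrite ger0_norm ?invr_ge0 ?(ltW (Y_diag_gt0 _ _)) //.
by rewrite lef_pV2 ?posrE ?Y_diag_gt0 //; case: (wP k u).
Qed.

Lemma invmx_Ytilde_cvg : exists2 T, 0 <= T & forall k v,
  norm2 (invmx (Ytilde p A k) *m v - diag_mx (\row_u (P u u)^-1) *m v)
  <= T * sigma ^+ k * norm2 v.
Proof.
have [w w0 wP] := Y_diag_lower_bound.
exists (T0 / (w * w)) => [|k v]; first by rewrite divr_ge0 // mulr_ge0 // ltW.
rewrite invmx_Ytilde -mulmxBl.
have -> : diag_mx (\row_u (Y p A k u u)^-1) - diag_mx (\row_u (P u u)^-1) =
    diag_mx (\row_u ((Y p A k u u)^-1 - (P u u)^-1)).
  by rewrite -linearB; congr diag_mx; apply/rowP => u; rewrite !mxE.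
apply: norm2_diag => [|u]; first by rewrite mulr_ge0 ?exprn_ge0 // divr_ge0 // mulr_ge0 // ltW.
have [wY wPu] := wP k u; have Yu := Y_diag_gt0 k u; have Pu := Yinf_diag_gt0 u.
have -> : (Y p A k u u)^-1 - (P u u)^-1 =
    (P u u - Y p A k u u) / (Y p A k u u * P u u).
  by field; rewrite !gt_eqF.
rewrite normrM distrC mulrAC; apply: ler_pM => //; first exact: Y_diag_cvg.
rewrite ger0_norm; last by rewrite invr_ge0 ltW // mulr_gt0.
by rewrite lef_pV2 ?posrE ?mulr_gt0 // ler_pM // ltW.
Qed.

Lemma spectral_norm_Y_has_ubound : has_ubound (range (fun k => spectral_norm (Y p A k))).
Proof.
exists (spectral_norm P + T0) => _ [k _ <-].
apply: spectral_norm_le => [|v]; first by rewrite addr_ge0 ?spectral_norm_ge0.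
rewrite -(subrK (P *m v) (Y p A k *m v)) addrC mulrDl (le_trans (norm2D _ _)) //.
apply: lerD; first exact: norm2_mulmx.
apply: le_trans (Y_cvg k v) _; rewrite ler_wpM2r ?norm2_ge0 // ler_piMr //.
by rewrite exprn_ile1 //; case/andP: sigma01 => _ /ltW.
Qed.

Lemma spectral_norm_invmx_Ytilde_has_ubound :
  has_ubound (range (fun k => spectral_norm (invmx (Ytilde p A k)))).
Proof.
have [C C0 CP] := invmx_Ytilde_le.
by exists C => _ [k _ <-]; exact: spectral_norm_le.
Qed.

(** The supremum bounds each Y_k, and the bound passes to their limit; this is how [y] enters a5. *)
Lemma Yinf_le v :
  norm2 (P *m v) <= sup (range (fun k => spectral_norm (Y p A k))) * norm2 v.
Proof.
set y := sup _; apply/ler_addgt0Pl => e e0.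
have T1 : 0 < T0 * norm2 v + 1 by rewrite ltr_wpDl // mulr_ge0 // norm2_ge0.
have [K KP] : exists K, forall k, (K <= k)%N -> sigma ^+ k < e / (T0 * norm2 v + 1).
  apply: geometric_small; last by rewrite divr_gt0.
  by case/andP: sigma01 => /ltW -> ->.
have YK : norm2 (Y p A K *m v) <= y * norm2 v.
  apply: le_trans (norm2_mulmx _ _) _; rewrite ler_wpM2r ?norm2_ge0 //.
  by apply: ub_le_sup; [exact: spectral_norm_Y_has_ubound | exists K].
have := Y_cvg K v; have := norm2_dist (P *m v) (Y p A K *m v) 0.
rewrite !subr0 -[norm2 (P *m v - _)]norm2N opprB.
have := KP K (leqnn K); rewrite ltr_pdivlMr //.
have := exprn_ge0 K sigma_ge0; lra.
Qed.

End Weights.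

(** * The largest step-size *)

Section StepSizeVector.
Variables (R : realType) (n : nat).

Lemma max_entry_ub (v : 'cV[R]_n) i : v i 0 <= max_entry v.
Proof.
apply: ub_le_sup; last by exists i.
exists (\sum_j `|v j 0|) => _ [j _ <-]; rewrite (bigD1 j) //=.
by rewrite (le_trans (ler_norm _)) // lerDl sumr_ge0.
Qed.

(** With no agents the range is empty and its [sup] is 0. *)
Lemma max_entry_gt0 (v : 'cV[R]_n) : 0 < max_entry v -> (0 < n)%N.
Proof.
rewrite lt0n; apply: contraTneq => n0; subst n.
suff e : range (fun i => v i 0) = set0 by rewrite /max_entry e sup0 ltxx.
by apply/seteqP; split=> [x [[]]|x []].
Qed.

End StepSizeVector.

(** * Instantiation with the FROST matrices *)

Theorem theorem2 (R : realType) (n p : nat) (E : rel 'I_n)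
    (f : 'I_n -> 'cV[R]_p -> R) (l mu : R) (xstar : 'cV[R]_p)
    (A : 'M[R]_n) (pi_r alpha : 'cV[R]_n) (x0 : 'cV[R]_(n * p))
    (N : 'cV[R]_(n * p) -> R) (sigma c d delta1 delta2 delta3 : R) :
  strongly_connected E ->
  (forall i, i \in in_neighbors E i) ->
  0 < l -> 0 < mu ->
  (forall i x, differentiable (f i) x) ->
  (forall i, lipschitz_gradient l (f i)) ->
  (forall i, strongly_convex mu (f i)) ->
  (forall x, average f xstar <= average f x) ->
  row_stochastic A ->
  compatible_weights E A ->
  left_perron A pi_r ->
  (forall i, 0 <= alpha i 0) ->
  is_vector_norm N ->
  0 < sigma < 1 ->
  (forall a, N (kronI p A *m a - Yinf p pi_r *m a)
             <= sigma * N (a - Yinf p pi_r *m a)) ->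
  0 < c -> 0 < d ->
  (forall a, norm2 a <= c * N a) ->
  (forall a, N a <= d * norm2 a) ->
  let tau := spectral_norm (kronI p A - 1%:M) in
  let eps := spectral_norm (1%:M - Yinf p pi_r) in
  let y := sup (range (fun k => spectral_norm (Y p A k))) in
  let ytilde := sup (range (fun k => spectral_norm (invmx (Ytilde p A k)))) in
  let a1 := c * d * eps * n%:R * l in
  let a2 := d * eps * n%:R * l in
  let a3 := c * d * eps in
  let a4 := c * n%:R * l in
  let a5 := y * c in
  let a6 := eps * ytilde * l * tau * c * d in
  let a7 := c * d * n%:R * l ^+ 2 * eps * ytilde in
  let a8 := d * n%:R * l ^+ 2 * eps * ytilde in
  let a9 := c * d * eps * l * ytilde in
  let abar := max_entry alpha in
  let pa := (pi_r^T *m alpha) 0 0 in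
  let lambda := Num.max `|1 - n%:R * pa * mu| `|1 - n%:R * pa * l| in
  let J := mx_of_rows 3
    [:: [:: sigma + a1 * abar; a2 * abar; a3 * abar ];
        [:: a4 * abar;         lambda;    a5 * abar ];
        [:: a6 + a7 * abar;    a8 * abar; sigma + a9 * abar ]] in
  0 < delta1 -> 0 < delta2 -> 0 < delta3 ->
  (delta1%:E < quotient_bound ((1 - sigma) * delta3) a6)%E ->
  (a4 * delta1 + a5 * delta3) / (mu * n%:R * min_entry pi_r) < delta2 ->
  0 < abar ->
  (abar%:E <
     Order.min (quotient_bound (delta1 * (1 - sigma))
                               (a1 * delta1 + a2 * delta2 + a3 * delta3))
    (Order.min (quotient_bound ((1 - sigma) * delta3 - delta1 * a6)
                               (a7 * delta1 + a8 * delta2 + a9 * delta3))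
               (quotient_bound 1 (n%:R * l))))%E ->
  forall xi : R, 0 < xi ->
  exists2 m : R, 0 < m &
    forall k : nat,
      N (frost_x A alpha f x0 k - consensus n xstar)
      <= m * (Num.max (spectral_radius J) sigma + xi) ^+ k.
Proof.
move=> _ loops l0 mu0 _ f_lip f_convex xmin A_stoch A_weights pi_perron alpha0.
move=> N_norm sigma01 A_contr c0 d0 cN dN.
move=> tau eps y ytilde a1 a2 a3 a4 a5 a6 a7 a8 a9 abar pa lambda J.
move=> _ _ _ _ _ abar0 + xi xi0.
rewrite !lt_min => /and3P[_ _].
have n0 : (0 < n)%N by exact: (max_entry_gt0 abar0).
have nl0 : 0 < n%:R * l by rewrite mulr_gt0 ?ltr0n.
rewrite /quotient_bound inver gt_eqF // -EFinM lte_fin mul1r => abar_lt.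
have A_diag i : 0 < A i i by case: (A_weights i i) => + _; apply.
have alpha_le i : alpha i 0 <= abar by exact: max_entry_ub.
have abar_ge0 := ltW abar0.
have [pi0 _ pi1] := pi_perron.
have paE : pa = \sum_i pi_r i 0 * alpha i 0.
  by rewrite /pa mxE; apply: eq_bigr => i _; rewrite mxE.
have sum_pi : \sum_i pi_r i 0 = 1.
  have <- : (pi_r^T *m (const_mx 1 : 'cV_n)) 0 0 = 1 by rewrite pi1 mxE.
  by rewrite mxE; apply: eq_bigr => i _; rewrite !mxE mulr1.
have pa0 : 0 <= pa.
  by rewrite paE; apply: sumr_ge0 => i _; rewrite mulr_ge0 // ltW.
(* [pa] is the mean of the step-sizes with weights [pi_r]. *)
have pa_le : pa <= abar.
  rewrite paE -[leRHS]mul1r -sum_pi mulr_suml; apply: ler_sum => i _.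
  by rewrite ler_wpM2l // ltW.
have pa_nl : pa * (n%:R * l) < 1.
  by apply: le_lt_trans (_ : abar * (n%:R * l) < 1);
    rewrite ?ler_wpM2r ?(ltW nl0) // -ltr_pdivlMr // mul1r.
have sigma0 : 0 < sigma by case/andP: sigma01.
have l_ge0 := ltW l0.
have n_ge0 : (0 : R) <= n%:R by [].
pose P := Yinf p pi_r; pose S : 'M[R]_(n * p) := kronI p (const_mx 1).
pose D := kronI p (diag_mx alpha^T).
pose W k := invmx (Ytilde p A k).
pose g := stacked_gradient f.
pose xs := consensus n xstar.
have eps_ge0 : 0 <= eps := spectral_norm_ge0 _.
have tau_ge0 : 0 <= tau := spectral_norm_ge0 _.
have y_ub := spectral_norm_Y_has_ubound pi_perron sigma01 c0 d0 A_contr cN dN.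
have yt_ub := spectral_norm_invmx_Ytilde_has_ubound A_stoch A_diag pi_perron
  sigma01 c0 d0 A_contr cN dN.
have y_ge0 : 0 <= y.
  by apply: le_trans (spectral_norm_ge0 (Y p A 0)) _; apply: ub_le_sup => //; exists 0%N.
have yt_ge0 : 0 <= ytilde.
  by apply: le_trans (spectral_norm_ge0 (W 0%N)) _; apply: ub_le_sup => //; exists 0%N.
have W_le k v : norm2 (W k *m v) <= ytilde * norm2 v.
  apply: le_trans (norm2_mulmx _ _) _; rewrite ler_wpM2r ?norm2_ge0 //.
  by apply: ub_le_sup => //; exists k.
have P_le := Yinf_le pi_perron sigma01 c0 d0 A_contr cN dN.
have [T T0 W_cvg] := invmx_Ytilde_cvg A_stoch A_diag pi_perron
  sigma01 c0 d0 A_contr cN dN.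
(* One constant for two estimates: applying P costs a factor [y], and consecutive inverse diagonals
   differ by at most twice their distance bound to the limit. *)
pose T' := (y + 2) * T.
have T'0 : 0 <= T' by rewrite mulr_ge0 // addr_ge0.
have PW_cvg k v : norm2 (P *m (W k *m v) - S *m v) <= T' * sigma ^+ k * norm2 v.
  rewrite /S -(Yinf_diag_inv _ pi_perron) -mulmxA -mulmxBr.
  apply: le_trans (P_le _) _; apply: le_trans (ler_wpM2l y_ge0 (W_cvg k v)) _.
  rewrite /T' !mulrA !ler_wpM2r ?norm2_ge0 ?exprn_ge0 ?(ltW sigma0) //.
  by rewrite lerDl.
have W_cauchy k v : norm2 (W k.+1 *m v - W k *m v) <= T' * sigma ^+ k * norm2 v.
  set w := diag_mx (\row_u (P u u)^-1) *m v.
  apply: le_trans (norm2_dist _ w _) _.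
  have := W_cvg k v; rewrite -norm2N opprB -/w => B.
  have := W_cvg k.+1 v; rewrite -/w => C.
  apply: le_trans (lerD C B) _.
  have sk : sigma ^+ k.+1 <= sigma ^+ k.
    by rewrite ler_wiXn2l ?leqnSn ?(ltW sigma0) //; case/andP: sigma01 => _ /ltW.
  rewrite -mulrDl -mulrDr /T'; apply: ler_wpM2r (norm2_ge0 _) _ _ _.
  rewrite [_ * T]mulrC -mulrA ler_wpM2l //.
  have : 0 <= sigma ^+ k by rewrite exprn_ge0 // ltW.
  have := y_ge0; nra.
clearbody T'.
have W0 : W 0%N = 1%:M.
  rewrite /W (invmx_Ytilde p A_stoch A_diag) -diag_const_mx; congr diag_mx.
  by apply/rowP => u; rewrite /Y kronI1 !mxE eqxx invr1.
have g_lip := stacked_gradient_lipschitz l_ge0 f_lip.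
have gS v : S *m g v = consensus n (\sum_i gradient (f i) (block v i)).
  by rewrite kron_ones; congr consensus; apply: eq_bigr => i _; rewrite block_stack.
have Sg0 : S *m g xs = 0.
  rewrite gS; under eq_bigr do rewrite block_consensus.
  have -> : \sum_i gradient (f i) xstar = 0.
    exact: (sum_gradient_eq0 n0 l0 mu0 f_lip f_convex xmin).
  by rewrite -(scale0r xstar) consensusZ scale0r.
pose lambda' := `|1 - n%:R * pa * mu|.
have lambda_ge : lambda' <= lambda by rewrite /lambda le_max lexx.
have lambda_ge0 : 0 <= lambda := le_trans (normr_ge0 _) lambda_ge.
have gradient_step a : norm2 (P *m a - xs - pa *: (S *m g (P *m a))) <=
    lambda * norm2 (P *m a - xs).
  (* All blocks of P a equal the [pi_r]-weighted mean of the blocks of [a], so the estimate becomes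
     a single gradient step in R^p. *)
  have [w ->] : exists w, P *m a = consensus n w.
    exists (\sum_j pi_r j 0 *: block a j); apply: block_inj => i.
    rewrite block_kronI block_consensus; apply: eq_bigr => j _.
    by rewrite mxE big_ord1 !mxE mul1r.
  rewrite gS; under eq_bigr do rewrite block_consensus.
  rewrite -consensusZ -!consensusB; apply: norm2_consensus_le => //.
  apply: le_trans (ler_wpM2r (norm2_ge0 _) lambda_ge).
  exact: (sum_gradient_step n0 l0 mu0 f_lip f_convex xmin _ pa0 pa_nl).
have D_le v : norm2 (D *m v) <= abar * norm2 v.
  by apply: norm2_kron_diag => // i; rewrite ger0_norm.
have PDP : P *m D *m P = pa *: P.
  rewrite Yinf_kron_Yinf; congr (_ *: _); rewrite paE mxE; apply: eq_bigr => i _.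
  by rewrite mul_mx_diag !mxE mulr1.
have A1_le v : norm2 (kronI p A *m v - v) <= tau * norm2 v.
  by rewrite -{2}[v]mul1mx -mulmxBl; exact: norm2_mulmx.
have P1_le v : norm2 (v - P *m v) <= eps * norm2 v.
  by rewrite -{1}[v]mul1mx -mulmxBl; exact: norm2_mulmx.
pose x k := (frost A alpha f x0 k).1; pose z k := (frost A alpha f x0 k).2.
have xS k : x k.+1 = kronI p A *m x k - D *m z k.
  by rewrite /x /z /=; case: (frost A alpha f x0 k).
have zS k : z k.+1 = kronI p A *m z k + W k.+1 *m g (x k.+1) - W k *m g (x k).
  by rewrite xS /x /z /=; case: (frost A alpha f x0 k).
have z0 : z 0%N = g (x 0%N) by [].
have AP := kronA_Yinf p pi_r A_stoch; have PA := Yinf_kronA p pi_perron.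
have S_le := @norm2_kron_ones R n p.
exact: (geometric_error_decay N_norm c0 d0 cN dN sigma01 n_ge0 l_ge0 T'0 y_ge0 yt_ge0
  tau_ge0 eps_ge0 pa0 pa_le AP PA A_contr PDP D_le P_le S_le A1_le P1_le W0 W_le
  PW_cvg W_cauchy g_lip Sg0 gradient_step z0 xS zS lambda_ge0 xi0).
Qed.
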